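(* Let $\mathscr{J}$ be a Jacobi matrix with diagonal parameters $a_n\in\mathbb{R}$ and off-diagonal parameters $b_n>0$ ($n\ge0$). Let $$\beta_n:=-\frac{a_n}{2\sqrt{b_{n-1}b_n}},\qquad n\ge1.$$ Assume (i) $\sum_{n=1}^\infty b_n^{-1}<\infty$; (ii) $\sum_{n=1}^\infty|\beta_{n+1}-\beta_n|<\infty$ and $\lim_{n\to\infty}\beta_n\in(-1,1)$; (iii) $\displaystyle\sum_{n=1}^\infty\Big|\frac{b_n}{\sqrt{b_{n-1}b_{n+1}}}-1\Big|<\infty$. Then $\mathscr{J}$ is in limit circle case and the order $\rho$ of its Nevanlinna matrix $W$ is equal to the convergence exponent of $(b_n)_{n=0}^\infty$. If, additionally, $\sum_{n=0}^\infty b_n^{-\rho}<\infty$, then $W$ is of finite type with respect to its order.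
   Context: The Jacobi matrix $\mathscr{J}$ is the semi-infinite symmetric tridiagonal matrix with diagonal $(a_0,a_1,\dots)$ and off-diagonal $(b_0,b_1,\dots)$, where $a_n\in\mathbb{R}$, $b_n>0$. It is in limit circle case if its minimal operator in $\ell^2$ is symmetric with deficiency indices $(1,1)$ (as opposed to self-adjoint, the limit point case). Let $p_n,q_n$ be the orthogonal polynomials of the first and second kind, i.e. the solutions of $b_nu_{n+1}+a_nu_n+b_{n-1}u_{n-1}=zu_n$, $n\ge1$, with $p_0=1$, $p_1(z)=(z-a_0)/b_0$, $q_0=0$, $q_1=1/b_0$. In limit circle case, the Nevanlinna matrix $W=\begin{pmatrix}A&C\\ B&D\end{pmatrix}$ consists of the entire functions $$A(z)=z\sum_{n=0}^\infty q_n(0)q_n(z),\quad B(z)=-1+z\sum_{n=0}^\infty q_n(0)p_n(z),$$ $$C(z)=1+z\sum_{n=0}^\infty p_n(0)q_n(z),\quad D(z)=z\sum_{n=0}^\infty p_n(0)p_n(z).$$ All four entries $w_{ij}$ of $W$ have the same order $\rho:=\limsup_{r\to\infty}\frac{\log\log\max_{|z|=r}|w_{ij}(z)|}{\log r}$, called the order of $W$. $W$ is of finite type with respect to its order if $\limsup_{r\to\infty}r^{-\rho}\log\max_{|z|=r}|w_{ij}(z)|<\infty$ for its entries. The convergence exponent of a sequence $(\lambda_n)$ of nonzero numbers is $\inf\{\alpha>0 : \sum_n|\lambda_n|^{-\alpha}<\infty\}$. *)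

(* Defs.v *)
From HB Require Import structures.
From mathcomp Require Import all_boot all_order all_algebra.
From mathcomp Require Import complex.
From mathcomp Require Import all_classical all_reals all_analysis.

Set Implicit Arguments.
Unset Strict Implicit.
Unset Printing Implicit Defensive.

Import Order.TTheory GRing.Theory Num.Theory.
Import numFieldNormedType.Exports.

Local Open Scope classical_set_scope.
Local Open Scope ring_scope.
Local Open Scope complex_scope.

(* Real-valued modulus; the norm `|z| of R[i] takes its values in R[i]. *)
Definition cmod {R : realType} (z : R[i]) : R := ComplexField.Normc.normc z.

(* Sum of a convergent series. It is stated over a numFieldType because the
   library puts a topology on the carrier of an abstract numFieldType, but
   registers none on R[i]. *)
Definition num_sum {K : numFieldType} (u : nat -> K) : K := limn (series u).

(** ** The Hilbert space l^2 of complex sequences *)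

Section l2.
Context {R : realType}.
Local Notation C := R[i].

Definition l2_sqnorm (u : nat -> C) : \bar R :=
  (\sum_(0 <= n <oo) (cmod (u n) ^+ 2)%:E)%E.

Definition l2 : set (nat -> C) := [set u | (l2_sqnorm u < +oo)%E].

(* Meaningful for u, v in l2, where the series converges absolutely. *)
Definition l2_inner (u v : nat -> C) : C :=
  num_sum (fun n => u n * conjc (v n)).

(** *** Operators in l^2, identified with their graphs *)

Definition graph_dom (T : set ((nat -> C) * (nat -> C))) : set (nat -> C) :=
  [set x | exists y, T (x, y)].

Definition l2_dense (D : set (nat -> C)) : Prop :=
  forall x, l2 x -> forall e : R, 0 < e ->
  exists2 d, D d & (l2_sqnorm (x - d)%R < e%:E)%E.

Definition graph_closure (T : set ((nat -> C) * (nat -> C))) :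
    set ((nat -> C) * (nat -> C)) :=
  [set xy | [/\ l2 xy.1, l2 xy.2 & forall e : R, 0 < e ->
     exists2 uv, T uv & (l2_sqnorm (xy.1 - uv.1)%R < e%:E)%E /\
                        (l2_sqnorm (xy.2 - uv.2)%R < e%:E)%E]].

Definition graph_adjoint (T : set ((nat -> C) * (nat -> C))) :
    set ((nat -> C) * (nat -> C)) :=
  [set xy | [/\ l2 xy.1, l2 xy.2 &
     forall uv, T uv -> l2_inner uv.2 xy.1 = l2_inner uv.1 xy.2]].

Definition symmetric_operator (T : set ((nat -> C) * (nat -> C))) : Prop :=
  l2_dense (graph_dom T) /\ T `<=` graph_adjoint T.

(* V is a linear subspace of dimension n: it has a basis with n elements. *)
Definition has_dim (V : set (nat -> C)) (n : nat) : Prop :=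
  exists e : 'I_n -> nat -> C,
    (forall c : 'I_n -> C, \sum_i c i *: e i = 0 -> forall i, c i = 0) /\
    V = [set \sum_i c i *: e i | c in [set: 'I_n -> C]].

(* ker (T^* - z) *)
Definition deficiency_space (T : set ((nat -> C) * (nat -> C))) (z : C) :
    set (nat -> C) :=
  [set x | graph_adjoint T (x, z *: x)].

Definition deficiency_indices (T : set ((nat -> C) * (nat -> C)))
    (np nm : nat) : Prop :=
  has_dim (deficiency_space T (0 +i* 1)) np /\
  has_dim (deficiency_space T (0 -i* 1)) nm.

End l2.

(** ** Jacobi matrices *)

Section Jacobi.
Context {R : realType}.
Local Notation C := R[i].
Variables a b : nat -> R.

Definition jacobi_apply (u : nat -> C) : nat -> C := fun n =>
  if n is m.+1
  then (b m)%:C * u m + (a n)%:C * u n + (b n)%:C * u n.+1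
  else (a 0)%:C * u 0 + (b 0)%:C * u 1.

Definition finitely_supported : set (nat -> C) :=
  [set u | exists N, forall n, (N <= n)%N -> u n = 0].

(* Closure of the matrix acting on finitely supported sequences. *)
Definition jacobi_min : set ((nat -> C) * (nat -> C)) :=
  graph_closure [set (u, jacobi_apply u) | u in finitely_supported].

Definition limit_circle : Prop :=
  symmetric_operator jacobi_min /\ deficiency_indices jacobi_min 1 1.

(* The solution of b_n u_(n+1) + a_n u_n + b_(n-1) u_(n-1) = z u_n (n >= 1)
   with prescribed u_0 and u_1. *)
Fixpoint jacobi_sol (z u0 u1 : C) (n : nat) {struct n} : C :=
  match n with
  | 0 => u0
  | n'.+1 =>
    match n' with
    | 0 => u1
    | m.+1 => ((z - (a n')%:C) * jacobi_sol z u0 u1 n'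
               - (b m)%:C * jacobi_sol z u0 u1 m) / (b n')%:C
    end
  end.

Definition orthopoly1 (n : nat) (z : C) : C :=
  jacobi_sol z 1 ((z - (a 0)%:C) / (b 0)%:C) n.

Definition orthopoly2 (n : nat) (z : C) : C :=
  jacobi_sol z 0 (1 / (b 0)%:C) n.

Local Notation p := orthopoly1.
Local Notation q := orthopoly2.

(* Meaningful in limit circle case, where these series converge. *)
Definition nevanlinnaA (z : C) : C := z * num_sum (fun n => q n 0 * q n z).
Definition nevanlinnaB (z : C) : C :=
  - 1 + z * num_sum (fun n => q n 0 * p n z).
Definition nevanlinnaC (z : C) : C :=
  1 + z * num_sum (fun n => p n 0 * q n z).
Definition nevanlinnaD (z : C) : C := z * num_sum (fun n => p n 0 * p n z).

Definition nevanlinna (z : C) : 'M[C]_2 :=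
  block_mx (nevanlinnaA z)%:M (nevanlinnaC z)%:M
           (nevanlinnaB z)%:M (nevanlinnaD z)%:M : 'M[C]_(1 + 1).

(* Only meant for n >= 1. *)
Definition jacobi_beta (n : nat) : R :=
  - (a n / (2 * Num.sqrt (b n.-1 * b n))).

End Jacobi.

(** ** Growth *)

Section growth.
Context {R : realType}.
Local Notation C := R[i].

(* max_(|z| = r) |w z| *)
Definition max_modulus (w : C -> C) (r : R) : R :=
  sup [set cmod (w z) | z in [set z | cmod z = r]].

Definition growth_order (w : C -> C) : \bar R :=
  limf_esup (fun r : R => (ln (ln (max_modulus w r)) / ln r)%:E)
            (pinfty_nbhs R).

Definition growth_type (rho : R) (w : C -> C) : \bar R :=
  limf_esup (fun r : R => (r `^ (- rho) * ln (max_modulus w r))%:E)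
            (pinfty_nbhs R).

(* The order of a matrix function is the common order of its entries. *)
Definition mx_has_order (W : C -> 'M[C]_2) (rho : \bar R) : Prop :=
  forall i j : 'I_2, growth_order (fun z => W z i j) = rho.

Definition mx_finite_type (W : C -> 'M[C]_2) (rho : R) : Prop :=
  forall i j : 'I_2, (growth_type rho (fun z => W z i j) < +oo)%E.

Definition convergence_exponent (l : nat -> R) : \bar R :=
  ereal_inf [set alpha%:E | alpha in [set alpha : R | 0 < alpha /\
    (\sum_(0 <= n <oo) (`|l n| `^ (- alpha))%:E < +oo)%E]].

End growth.

(* Main.v *)
Require Import Defs.
From HB Require Import structures.
From mathcomp Require Import all_boot all_order all_algebra.
From mathcomp Require Import complex.
From mathcomp Require Import all_classical all_reals all_analysis.
From mathcomp Require Import ring lra.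

Import Order.TTheory GRing.Theory Num.Theory.
Import numFieldNormedType.Exports.

Local Open Scope classical_set_scope.
Local Open Scope ring_scope.

(** Let [p], [q] be the orthogonal polynomials of the first and second kind, and
    [P_n], [Q_n] their values at 0.

    Only the point [z = 0] needs asymptotic analysis. Put
    [c_n = sqrt (b_n / b_(n-1))]. For a real solution [u] at [z = 0] the quadratic
    form [b_(n-1) (c_n u_n^2 - 2 beta_n u_n u_(n-1) + u_(n-1)^2 / c_n)] would be
    conserved if [c] and [beta] were constant, and it is definite as
    [|beta| < 1] eventually. By hypothesis [beta] has bounded variation, and the
    regularity of [b] gives the same for [c] and [1/c]; so the form stays bounded
    and [u_n^2 = O(1 / b_n)] ([real_solution_bounded]). Hence [h_n = (|P_n| + |Q_n|)^2 = O(1 / b_n)],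
    which is summable.

    Variation of constants writes a solution at [z] as [- X_n P_n + Y_n Q_n],
    where [(X_n, Y_n)] obeys a first-order system whose [n]-th step has size
    [|z| h_n]; the limits of [X_n], [Y_n] are [B], [D] for [p] and [A], [C] for
    [q]. Therefore [p(z)] and [q(z)] are square summable, which gives the limit
    circle case, and each entry is bounded by [\prod_n (1 + K |z| / b_n)]. The
    inequality [ln (1 + t) <= t^al / al] turns this into the bound
    [exp (K' |z|^al)] for every [al] in [(0, 1]] with [\sum_n b_n^(-al)] finite
    ([coeff_size_le]): the order is at most the convergence exponent, and the
    type is finite if [al] can be taken equal to the order.

    The lower bound is taken on the imaginary axis [z = i y]. With
    [S_n = \sum_(k < n) |u_k|^2], Green's identity gives
    [y S_(n+1) = b_n Im (u_(n+1) conj u_n) <= b_n |u_n| |u_(n+1)|], whence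
    [S_(n+2) >= (1 + 2 y / b_n) S_n] ([sqsum_growth]), and [S_n S_(n+1)] dominates
    a constant times [\prod_(2 <= k < n) (1 + 2 y / b_k)]. Moreover
    [y S_n = Im (X_n conj Y_n)], while [|X_n|] and [|Y_n|] are [O(y sqrt S_n)] by
    Cauchy-Schwarz; so both are at least a constant times [sqrt S_n]. This holds
    for all four entries ([lim_coeffs_lower_bound]). If the order were below
    [al], then [\sum_k ln (1 + 2 r / b_k)] would be [O(r^al)], and summing this
    over [r = 2^j] with weights [2^(- j al')] shows [\sum_k b_k^(- al')] finite
    for each [al' > al] ([summable_of_log_product]). *)

Set Implicit Arguments.
Unset Strict Implicit.
Unset Printing Implicit Defensive.

(** * Summable real sequences *)

Section RealSequences.
Context {R : realType}.
Implicit Types (e x : nat -> R).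

(** Boundedness of the partial sums; for nonnegative terms this is summability. *)
Definition bounded_sums e : Prop :=
  exists M, forall n, \sum_(0 <= k < n) e k <= M.

Lemma bounded_sums_tail e N M : (forall n, 0 <= e n) ->
  (forall n, (N <= n)%N -> \sum_(N <= k < n) e k <= M) -> bounded_sums e.
Proof.
move=> e0 eM; exists (\sum_(0 <= k < N) e k + M) => n.
apply: (@le_trans _ _ (\sum_(0 <= k < maxn n N) e k)).
  rewrite [leRHS](big_cat_nat _ (n := n)) //= ?leq_maxl // lerDl.
  by apply: sumr_ge0.
rewrite [leLHS](big_cat_nat _ (n := N)) //= ?leq_maxr // lerD2l.
by rewrite eM ?leq_maxr.
Qed.

Lemma bounded_sums_of_nneseries e m : (forall n, 0 <= e n) ->
  (\sum_(m <= n <oo) (e n)%:E < +oo)%E -> bounded_sums e.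
Proof.
move=> e0 fin_e.
have fin_s : (\sum_(m <= k <oo) (e k)%:E)%E \is a fin_num.
  by rewrite ge0_fin_numE //; apply: nneseries_ge0 => n _ _; rewrite lee_fin.
apply: (bounded_sums_tail (N := m)
  (M := fine (\sum_(m <= k <oo) (e k)%:E)%E) e0) => n _.
rewrite -lee_fin fineK // -sumEFin.
by apply: nneseries_lim_ge => i _ _; rewrite lee_fin.
Qed.

Lemma nneseries_of_bounded_sums e : (forall n, 0 <= e n) ->
  bounded_sums e -> (\sum_(0 <= n <oo) (e n)%:E < +oo)%E.
Proof.
move=> e0 [M eM]; apply: (@le_lt_trans _ _ M%:E); last exact: ltry.
apply: lime_le; first by apply: is_cvg_nneseries => n _ _; rewrite lee_fin.
by apply: nearW => n; rewrite sumEFin lee_fin.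
Qed.

Lemma bounded_sums_le e e' c N : (forall n, 0 <= e n) -> 0 <= c ->
  (forall n, (N <= n)%N -> e n <= c * e' n) -> (forall n, 0 <= e' n) ->
  bounded_sums e' -> bounded_sums e.
Proof.
move=> e0 c0 ee' e'0 [M e'M].
apply: (bounded_sums_tail (N := N) (M := c * M) e0) => n Nn.
apply: (@le_trans _ _ (c * \sum_(N <= k < n) e' k)).
  by rewrite mulr_sumr; apply: ler_sum_nat => i /andP[/ee'].
rewrite ler_wpM2l //; apply: le_trans (e'M n).
by rewrite [leRHS](big_cat_nat _ (n := N)) //= lerDr sumr_ge0.
Qed.

Lemma bounded_sumsD e e' : bounded_sums e -> bounded_sums e' ->
  bounded_sums (fun n => e n + e' n).
Proof.
by move=> [M eM] [M' e'M]; exists (M + M') => n; rewrite big_split lerD.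
Qed.

Lemma bounded_sumsZ e c : 0 <= c -> bounded_sums e ->
  bounded_sums (fun n => c * e n).
Proof. by move=> c0 [M eM]; exists (c * M) => n; rewrite -mulr_sumr ler_wpM2l. Qed.

Lemma bounded_sums_shift e : (forall n, 0 <= e n) -> bounded_sums e ->
  bounded_sums (fun n => e n.+1).
Proof.
move=> e0 [M eM]; exists M => n; apply: le_trans (eM n.+1).
by rewrite big_nat_recl // lerDr.
Qed.

Lemma bounded_sums_small e d : (forall n, 0 <= e n) -> bounded_sums e ->
  0 < d -> exists N, forall n, (N <= n)%N -> e n < d.
Proof.
move=> e0 [M eM] d0.
have cs : cvgn (series e).
  apply: nondecreasing_is_cvgn.
    by apply/nondecreasing_seqP => n; rewrite seriesSr lerDl.
  by exists M => _ [n _ <-]; exact: eM.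
have /cvgrPdist_lt /(_ _ d0) [N _ HN] := cvg_series_cvg_0 cs.
by exists N => n /HN; rewrite sub0r normrN ger0_norm.
Qed.

(** A nonnegative sequence whose growth factors [1 + e n] are summable
    perturbations of 1 is bounded. *)
Lemma quasi_decreasing_bounded x e N : (forall n, 0 <= e n) ->
  bounded_sums e -> (forall n, 0 <= x n) ->
  (forall n, (N <= n)%N -> x n.+1 <= x n * (1 + e n)) ->
  exists2 B, 0 <= B & forall n, x n <= B.
Proof.
move=> e0 [M eM] x0 xS.
have bnd n : x (N + n)%N <= x N * expR (\sum_(N <= k < N + n) e k).
  elim: n => [|n IHn]; first by rewrite addn0 big_geq // expR0 mulr1.
  rewrite addnS big_nat_recr ?leq_addr //= expRD mulrA.
  apply: (le_trans (xS _ (leq_addr _ _))).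
  apply: ler_pM => //; first by rewrite addr_ge0.
  exact: expR_ge1Dx.
exists (\sum_(0 <= k < N) x k + x N * expR M) => [|n].
  by rewrite addr_ge0 ?mulr_ge0 ?sumr_ge0 ?expR_ge0.
have [nN|Nn] := ltnP n N.
  rewrite (bigD1_seq n) ?mem_index_iota ?iota_uniq //= -addrA lerDl.
  by rewrite addr_ge0 ?mulr_ge0 ?expR_ge0 ?sumr_ge0.
rewrite -(subnKC Nn); apply: (le_trans (bnd _)); rewrite -[leLHS]add0r lerD //.
  by rewrite sumr_ge0.
rewrite ler_wpM2l // ler_expR; apply: le_trans (eM (N + (n - N))%N).
by rewrite [leRHS](big_cat_nat _ (n := N)) //= ?leq_addr // lerDr sumr_ge0.
Qed.

(** Exponentiated form of [ln (1 + t) <= t ^ al / al]. *)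
Lemma ln1D_le_powR (al t : R) : 0 < al <= 1 -> 0 <= t ->
  1 + t <= expR (t `^ al / al).
Proof.
move=> /andP[al0 al1]; rewrite le_eqVlt => /orP[/eqP <-|t0].
  by rewrite addr0 -expR0 ler_expR divr_ge0 ?powR_ge0 ?ltW.
have t10 : 0 < 1 + t by rewrite addr_gt0.
have key : (1 + t) `^ al <= 1 + t `^ al.
  (* subadditivity of the power function, from s <= s^al for s in [0, 1] *)
  have frac s : 0 < s -> s <= 1 -> s <= s `^ al.
    by move=> s0 s1; rewrite -{1}(powRr1 (ltW s0)) ger_powR ?s0.
  have f1 : (1 + t)^-1 <= (1 + t)^-1 `^ al.
    by apply: frac; rewrite ?invr_gt0 // invf_le1 // lerDl ltW.
  have f2 : t / (1 + t) <= (t / (1 + t)) `^ al.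
    by apply: frac; rewrite ?divr_gt0 // ler_pdivrMr // mul1r lerDr.
  have -> : 1 + t `^ al =
      (1 + t) `^ al * ((1 + t)^-1 `^ al + (t / (1 + t)) `^ al).
    rewrite mulrDr -!powRM ?invr_ge0 ?divr_ge0 ?ltW //.
    by rewrite divff ?gt_eqF // powR1 mulrCA divff ?gt_eqF // mulr1.
  rewrite ler_peMr ?powR_ge0 //; apply: le_trans (lerD f1 f2).
  by rewrite -[X in X + _]mul1r -mulrDl divff ?gt_eqF.
rewrite -ler_ln ?posrE ?expR_gt0 // expRK ler_pdivlMr // mulrC -ln_powR.
apply: (le_trans (y := ln (1 + t `^ al))).
  by rewrite ler_ln ?posrE ?powR_gt0 // addr_gt0 ?powR_gt0.
by apply: le_ln1Dx; rewrite (lt_le_trans _ (powR_ge0 _ _)) // oppr_lt0.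
Qed.

End RealSequences.

(** * Real solutions at spectral parameter 0 *)

Section RealSolutions.
Context {R : realType}.
Variables a b : nat -> R.
Hypothesis b_gt0 : forall n, 0 < b n.

(** Square root of the ratio [b_(n+1) / b_n]. *)
Definition sqrt_ratio (n : nat) : R := Num.sqrt (b n.+1 / b n).
Local Notation c := sqrt_ratio.

Lemma sqrt_ratio_gt0 n : 0 < c n.
Proof. by rewrite sqrtr_gt0 divr_gt0. Qed.

Lemma offdiag_sqrt_ratio n : b n.+1 = c n ^+ 2 * b n.
Proof. by rewrite sqr_sqrtr ?divr_ge0 ?ltW // divfK // gt_eqF. Qed.

Lemma sqrt_mul_offdiag n : Num.sqrt (b n * b n.+1) = c n * b n.
Proof.
rewrite offdiag_sqrt_ratio; have -> : b n * (c n ^+ 2 * b n) = (c n * b n) ^+ 2 by ring.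
by rewrite sqrtr_sqr ger0_norm // mulr_ge0 // ltW ?sqrt_ratio_gt0.
Qed.

Lemma diag_jacobi_beta n : a n.+1 = - 2 * jacobi_beta a b n.+1 * c n * b n.
Proof.
rewrite /jacobi_beta /= sqrt_mul_offdiag.
by field; rewrite !gt_eqF ?sqrt_ratio_gt0.
Qed.

Lemma regularity_sqrt_ratio n :
  b n.+1 / Num.sqrt (b n * b n.+2) = c n / c n.+1.
Proof.
have -> : b n * b n.+2 = (c n.+1 * c n * b n) ^+ 2.
  by rewrite !offdiag_sqrt_ratio; ring.
rewrite sqrtr_sqr ger0_norm ?mulr_ge0 // ?ltW ?sqrt_ratio_gt0 //.
rewrite offdiag_sqrt_ratio.
by field; rewrite !gt_eqF ?sqrt_ratio_gt0.
Qed.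

Section Regular.
Hypothesis reg_b : bounded_sums
  (fun n => `|b n / Num.sqrt (b n.-1 * b n.+1) - 1|).

Let e n : R := `|c n / c n.+1 - 1|.

Let bs_e : bounded_sums e.
Proof.
have [M eM] := bounded_sums_shift (fun n => normr_ge0 _) reg_b.
exists M => n; apply: le_trans (eM n); apply: ler_sum => k _.
by rewrite /e regularity_sqrt_ratio.
Qed.

(** The regularity condition says that [c_n / c_(n+1)] is a summable
    perturbation of 1, so both [c] and [1 / c] are quasi-decreasing. *)
Lemma sqrt_ratio_bounded : exists2 L, 0 < L &
  forall n, c n <= L /\ (c n)^-1 <= L.
Proof.
have half0 : 0 < 2^-1 :> R by rewrite invr_gt0 ltr0n.
have [N eN] := bounded_sums_small (fun n => normr_ge0 _) bs_e half0.
have bs_2e : bounded_sums (fun n => 2 * e n) by exact: bounded_sumsZ.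
have [B1 B10 cB1] : exists2 B, 0 <= B & forall n, c n <= B.
  apply: (@quasi_decreasing_bounded _ c _ N _ bs_2e) => n.
  - by rewrite mulr_ge0 ?normr_ge0.
  - exact/ltW/sqrt_ratio_gt0.
  - move=> /eN; rewrite -/(e n) => en.
    have c1 := sqrt_ratio_gt0 n.+1; have c0 := sqrt_ratio_gt0 n.
    have re : 1 - e n <= c n / c n.+1.
      by rewrite lerBlDr -lerBlDl /e distrC ler_norm.
    have {1}-> : c n.+1 = c n / (c n / c n.+1) by field; rewrite !gt_eqF.
    rewrite ler_wpM2l ?(ltW c0) // invf_ple ?posrE ?divr_gt0 //; last first.
      by rewrite ltr_wpDr ?mulr_ge0 ?normr_ge0.
    apply: le_trans re; rewrite -div1r ler_pdivrMr; last first.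
      by rewrite ltr_wpDr ?mulr_ge0 ?normr_ge0.
    have : 0 <= e n by rewrite normr_ge0.
    by nra.
have [B2 B20 cB2] : exists2 B, 0 <= B & forall n, (c n)^-1 <= B.
  apply: (@quasi_decreasing_bounded _ (fun n => (c n)^-1) _ N _ bs_e) => n.
  - by rewrite normr_ge0.
  - by rewrite invr_ge0 ltW ?sqrt_ratio_gt0.
  - move=> _; have c1 := sqrt_ratio_gt0 n.+1; have c0 := sqrt_ratio_gt0 n.
    have -> : (c n.+1)^-1 = (c n)^-1 * (c n / c n.+1).
      by field; rewrite !gt_eqF.
    rewrite ler_wpM2l ?invr_ge0 ?(ltW c0) // -lerBlDl /e; exact: ler_norm.
exists (1 + B1 + B2) => [|n]; first by rewrite -addrA ltr_wpDr ?addr_ge0.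
by have := cB1 n; have := cB2 n; split; lra.
Qed.

Lemma sqrt_ratio_bounded_variation :
  bounded_sums (fun n => `|c n.+1 - c n|) /\
  bounded_sums (fun n => `|(c n.+1)^-1 - (c n)^-1|).
Proof.
have [L L0 cL] := sqrt_ratio_bounded.
have pos := sqrt_ratio_gt0.
have e0 n : 0 <= e n by exact: normr_ge0.
have L0' := ltW L0.
split; apply: (@bounded_sums_le _ _ e L 0) => // n _;
  have c1 := pos n.+1; have c0 := pos n.
  have -> : c n.+1 - c n = - (c n.+1 * (c n / c n.+1 - 1)).
    by field; rewrite !gt_eqF.
  by rewrite normrN normrM (ger0_norm (ltW c1)) ler_wpM2r // (cL _).1.
have -> : (c n.+1)^-1 - (c n)^-1 = (c n)^-1 * (c n / c n.+1 - 1).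
  by field; rewrite !gt_eqF.
by rewrite normrM ger0_norm ?invr_ge0 ?(ltW c0) // ler_wpM2r // (cL _).2.
Qed.

Hypothesis bv_beta :
  bounded_sums (fun n => `|jacobi_beta a b n.+1 - jacobi_beta a b n|).
Hypothesis lim_beta : exists2 l : R,
     (jacobi_beta a b n @[n --> \oo] --> l) & -1 < l < 1.

Let beta n : R := jacobi_beta a b n.+1.

Let beta_small : exists2 eta, 0 < eta &
  exists N, forall n, (N <= n)%N -> `|beta n| <= 1 - eta.
Proof.
have [l bl /andP[l1 l2]] := lim_beta.
have l0 : 0 < (1 - `|l|) / 2 by rewrite divr_gt0 // subr_gt0 ltr_norml l1.
exists ((1 - `|l|) / 2) => //.
move/cvgrPdist_lt : bl => /(_ _ l0) [N _ HN].
exists N => n Nn; have := HN n.+1 (leqW Nn).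
rewrite -/(beta n) => lb.
have : `|beta n| <= `|l| + `|l - beta n|.
  by rewrite -{1}(subKr l (beta n)) (le_trans (ler_normB _ _)).
move: lb; set x := `|l - _|; set y := `|beta n|; set t := `|l|; lra.
Qed.

(** Every real solution of the three-term recurrence at [z = 0] is
    [O(b_n ^ (-1/2))]. The quadratic form [E] below is exactly conserved when
    [c] and [beta] are constant, and it is definite because [|beta| < 1]; since
    [c], [1/c] and [beta] have bounded variation, it stays bounded. *)
Lemma real_solution_bounded (u : nat -> R) :
  (forall n, b n.+1 * u n.+2 + a n.+1 * u n.+1 + b n * u n = 0) ->
  exists K, forall n, b n * u n ^+ 2 <= K.
Proof.
move=> urec.
have [L L0 cL] := sqrt_ratio_bounded.
have [bv_c bv_ci] := sqrt_ratio_bounded_variation.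
have [eta eta0 [N bN]] := beta_small.
have pos := sqrt_ratio_gt0.
pose form (x y g t : R) := x * t ^+ 2 - 2 * g * t * y + x^-1 * y ^+ 2.
pose E n := b n * form (c n) (u n) (beta n) (u n.+1).
(* E n is also the form with coefficients of index n at the next two terms:
   this is the conservation law. *)
have Enext n : E n = b n.+1 * form (c n) (u n.+1) (beta n) (u n.+2).
  have u2 : u n.+2 = (2 * beta n * c n * u n.+1 - u n) / c n ^+ 2.
    have := urec n; rewrite diag_jacobi_beta offdiag_sqrt_ratio -/(beta n) => h.
    have c0 := pos n; have b0 := b_gt0 n.
    apply: (mulfI (_ : b n * c n ^+ 2 != 0)).
      by rewrite mulf_neq0 ?gt_eqF ?exprn_gt0.
    transitivity (b n * (2 * beta n * c n * u n.+1 - u n)).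
      by apply/eqP; rewrite -subr_eq0; apply/eqP; rewrite -[RHS]h; ring.
    by field; rewrite gt_eqF.
  rewrite /E /form u2 offdiag_sqrt_ratio; have c0 := pos n.
  by field; rewrite gt_eqF.
have form_ge n y t : (N <= n)%N ->
    eta / L * (y ^+ 2 + t ^+ 2) <= form (c n) y (beta n) t.
  move=> /bN bn; have [cn1 cn2] := cL n; have c0 := pos n.
  have Lc : L^-1 <= c n by rewrite invf_ple ?posrE.
  have Lci : L^-1 <= (c n)^-1 by rewrite lef_pV2 ?posrE.
  (* |2 t y| is at most c t^2 + y^2 / c, by completing the square *)
  have sq s : s ^+ 2 = 1 -> 0 <= c n * t ^+ 2 + (c n)^-1 * y ^+ 2 - 2 * s * t * y.
    move=> s1; have -> : c n * t ^+ 2 + (c n)^-1 * y ^+ 2 - 2 * s * t * y =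
        c n * (t - s * y / c n) ^+ 2 + (c n)^-1 * y ^+ 2 * (1 - s ^+ 2).
      by field; rewrite gt_eqF.
    by rewrite s1 subrr mulr0 addr0 mulr_ge0 ?sqr_ge0 ?ltW.
  have q1 := sq 1 (expr1n _ _); have q2 := sq (-1) (etrans (sqrrN _) (expr1n _ _)).
  have lo : L^-1 * (y ^+ 2 + t ^+ 2) <= c n * t ^+ 2 + (c n)^-1 * y ^+ 2.
    by rewrite mulrDr addrC lerD // ler_wpM2r ?sqr_ge0.
  rewrite -mulrA; apply: le_trans (_ : eta * (c n * t ^+ 2 + (c n)^-1 * y ^+ 2) <= _).
    by rewrite ler_wpM2l // ltW.
  move: bn q1 q2 lo; rewrite /form.
  set A := c n * _; set B := _ * y ^+ 2; set g := beta n.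
  rewrite ler_norml => /andP[g1 g2] q1 q2 _.
  have -> : 2 * g * t * y = g * (2 * t * y) by ring.
  have {}q1 : 2 * t * y <= A + B by lra.
  have {}q2 : - (A + B) <= 2 * t * y by lra.
  move: q1 q2; set w := 2 * t * y; set D := A + B => q1 q2.
  have -> : A - g * w + B = D - g * w by rewrite /D; ring.
  have D0 : 0 <= D by lra.
  by have [g0|g0] := leP 0 g; nra.
pose kap n := `|c n.+1 - c n| + (`|beta n.+1 - beta n| + `|(c n.+1)^-1 - (c n)^-1|).
have kap0 n : 0 <= kap n by rewrite !addr_ge0.
have bs_kap : bounded_sums kap.
  apply: bounded_sumsD => //; apply: bounded_sumsD => //.
  by apply: bounded_sums_shift bv_beta => n.
have dl0 : 0 < eta / L by rewrite divr_gt0.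
have E0 n : (N <= n)%N -> 0 <= E n.
  move=> Nn; rewrite mulr_ge0 ?(ltW (b_gt0 _)) //.
  apply: le_trans (form_ge _ _ _ Nn); apply: mulr_ge0; first exact: ltW.
  by rewrite addr_ge0 ?sqr_ge0.
have Estep n : (N <= n)%N -> E n.+1 <= E n * (1 + (eta / L)^-1 * kap n).
  move=> Nn.
  have diff : E n.+1 <= E n + kap n * (b n.+1 * (u n.+1 ^+ 2 + u n.+2 ^+ 2)).
    rewrite (Enext n) /E -lerBlDl -mulrBr mulrCA ler_wpM2l ?(ltW (b_gt0 _)) //.
    rewrite /form /kap.
    set x := u n.+1; set y := u n.+2.
    have -> : c n.+1 * y ^+ 2 - 2 * beta n.+1 * y * x + (c n.+1)^-1 * x ^+ 2 -
       (c n * y ^+ 2 - 2 * beta n * y * x + (c n)^-1 * x ^+ 2) =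
       (c n.+1 - c n) * y ^+ 2 - (beta n.+1 - beta n) * (2 * x * y) +
       ((c n.+1)^-1 - (c n)^-1) * x ^+ 2 by ring.
    set d1 := c n.+1 - _; set d2 := beta n.+1 - _; set d3 := _^-1 - _.
    have x2 := sqr_ge0 x; have y2 := sqr_ge0 y.
    have n1 := ler_norm d1; have n3 := ler_norm d3.
    have n10 := normr_ge0 d1; have n30 := normr_ge0 d3; have n20 := normr_ge0 d2.
    have m1 : d1 * y ^+ 2 <= `|d1| * (x ^+ 2 + y ^+ 2) by nra.
    have m3 : d3 * x ^+ 2 <= `|d3| * (x ^+ 2 + y ^+ 2) by nra.
    have m2 : - (d2 * (2 * x * y)) <= `|d2| * (x ^+ 2 + y ^+ 2).
      rewrite (le_trans (ler_norm _)) // normrN normrM ler_wpM2l //.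
      rewrite ler_norml; have := sqr_ge0 (x + y); have := sqr_ge0 (x - y).
      by rewrite !expr2 => *; apply/andP; split; nra.
    by rewrite !mulrDl in m1 m2 m3 *; lra.
  apply: (le_trans diff); rewrite [leRHS]mulrDr mulr1 lerD2l mulrC mulrA.
  rewrite ler_wpM2r // ler_pdivlMr // mulrC mulrCA Enext.
  by rewrite ler_wpM2l ?(ltW (b_gt0 _)) // form_ge.
have [B B0 EB] : exists2 B, 0 <= B & forall n, E (N + n)%N <= B.
  apply: (@quasi_decreasing_bounded _ (fun n => E (N + n)%N)
    (fun n => (eta / L)^-1 * kap (N + n)%N) 0) => [n||n|n _].
  - by rewrite mulr_ge0 // invr_ge0 ltW.
  - apply: bounded_sumsZ; first by rewrite invr_ge0 ltW.
    have [M kM] := bs_kap; exists M => n; apply: le_trans (kM (N + n)%N).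
    rewrite [leRHS](big_cat_nat _ (n := N)) ?leq_addr //=.
    have -> : \sum_(0 <= k < n) kap (N + k)%N = \sum_(N <= k < N + n) kap k.
      rewrite -{2}[N]add0n big_addn addKn.
      by apply: eq_bigr => k _; rewrite addnC.
    by rewrite lerDr sumr_ge0.
  - by rewrite E0 ?leq_addr.
  - by rewrite addnS Estep ?leq_addr.
exists (\sum_(0 <= k < N) b k * u k ^+ 2 + (eta / L)^-1 * B) => n.
have t0 k : 0 <= b k * u k ^+ 2 by rewrite mulr_ge0 ?sqr_ge0 ?(ltW (b_gt0 _)).
have [nN|Nn] := ltnP n N.
  rewrite (bigD1_seq n) ?mem_index_iota ?iota_uniq //= -addrA lerDl.
  by rewrite addr_ge0 ?mulr_ge0 ?invr_ge0 ?(ltW dl0) ?sumr_ge0.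
rewrite -[leLHS]add0r lerD ?sumr_ge0 // [leRHS]mulrC ler_pdivlMr //.
apply: le_trans (EB (n - N)%N); rewrite subnKC // mulrAC /E -mulrA.
rewrite ler_wpM2l ?(ltW (b_gt0 _)) //.
apply: le_trans (form_ge _ _ _ Nn); rewrite ler_wpM2l ?(ltW dl0) //.
by rewrite lerDl sqr_ge0.
Qed.

End Regular.
End RealSolutions.

(** * Complex series *)

(** The sum of a series over any numFieldType, by epsilons; the instance of
    interest is [R[i]]. *)
Lemma num_sum_eps (K : numFieldType) (u : nat -> K) (l : K) :
  (forall e : K, 0 < e ->
    exists N, forall n, (N <= n)%N -> `|\sum_(0 <= k < n) u k - l| < e) ->
  num_sum u = l.
Proof.
move=> ul; suff : series u @ \oo --> l by exact: cvg_lim.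
apply/cvgrPdist_lt => e /ul [N uN]; exists N => // n /= /uN.
by rewrite distrC.
Qed.

Section ComplexSeries.
Context {R : realType}.
Local Notation C := R[i].
Implicit Types (z w : C) (u v : nat -> C).

Lemma cmod_ge0 z : 0 <= cmod z.
Proof. by case: z => x y; rewrite sqrtr_ge0. Qed.

Lemma cmodM z w : cmod (z * w) = cmod z * cmod w.
Proof. exact: ComplexField.Normc.normcM. Qed.

Lemma cmodN z : cmod (- z) = cmod z.
Proof. exact: normcN. Qed.

Lemma cmodV z : cmod z^-1 = (cmod z)^-1.
Proof. exact: ComplexField.Normc.normcV. Qed.

Lemma le_cmodD z w : cmod (z + w) <= cmod z + cmod w.
Proof. exact: le_normcD. Qed.

Lemma le_cmodB z w : cmod (z - w) <= cmod z + cmod w.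
Proof. by rewrite -(cmodN w) le_cmodD. Qed.

Lemma cmod_real (x : R) : cmod x%:C%C = `|x|.
Proof. by rewrite /cmod /= expr0n addr0 sqrtr_sqr. Qed.

Lemma cmod0 : cmod (0 : C) = 0.
Proof. exact: ComplexField.Normc.normc0. Qed.

Lemma sqr_cmod z : cmod z ^+ 2 = complex.Re z ^+ 2 + complex.Im z ^+ 2.
Proof. by case: z => x y; rewrite sqr_sqrtr // addr_ge0 ?sqr_ge0. Qed.

Lemma cmod_conjc z : cmod (conjc z) = cmod z.
Proof. by case: z => x y; rewrite /cmod /= sqrrN. Qed.

Lemma normr_Re_le_cmod z : `|complex.Re z| <= cmod z.
Proof.
rewrite -(ler_pXn2r (ltn0Sn 1)) ?nnegrE ?cmod_ge0 // sqr_cmod.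
by rewrite real_normK ?num_real // lerDl sqr_ge0.
Qed.

Lemma normr_Im_le_cmod z : `|complex.Im z| <= cmod z.
Proof.
rewrite -(ler_pXn2r (ltn0Sn 1)) ?nnegrE ?cmod_ge0 // sqr_cmod.
by rewrite real_normK ?num_real // lerDr sqr_ge0.
Qed.

Lemma cmod_le_ReIm z : cmod z <= `|complex.Re z| + `|complex.Im z|.
Proof.
rewrite -(ler_pXn2r (ltn0Sn 1)) ?nnegrE ?cmod_ge0 ?addr_ge0 // sqr_cmod.
rewrite sqrrD !real_normK ?num_real // addrAC lerDl.
by rewrite mulrn_wge0 // mulr_ge0.
Qed.

Lemma eq0_cmod z : (forall e : R, 0 < e -> cmod z <= e) -> z = 0.
Proof.
move=> ze; apply: ComplexField.Normc.eq0_normc; apply/eqP.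
rewrite eq_le cmod_ge0 andbT.
by apply/ler_addgt0Pl => e /ze; rewrite addr0.
Qed.

Lemma le_cmod_sum n (u : nat -> C) :
  cmod (\sum_(0 <= k < n) u k) <= \sum_(0 <= k < n) cmod (u k).
Proof.
elim: n => [|n IHn]; first by rewrite !big_geq // cmod0.
by rewrite !big_nat_recr //= (le_trans (le_cmodD _ _)) // lerD2r.
Qed.

Lemma Re_sum n (u : nat -> C) :
  complex.Re (\sum_(0 <= k < n) u k) = \sum_(0 <= k < n) complex.Re (u k).
Proof. by apply: (big_morph (@complex.Re R)) => // -[? ?] []. Qed.

Lemma Im_sum n (u : nat -> C) :
  complex.Im (\sum_(0 <= k < n) u k) = \sum_(0 <= k < n) complex.Im (u k).
Proof. by apply: (big_morph (@complex.Im R)) => // -[? ?] []. Qed.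

(** Convergence of a complex series, in terms of the real-valued modulus. *)
Definition csum_to u (l : C) : Prop := forall e : R, 0 < e ->
  exists N, forall n, (N <= n)%N -> cmod (\sum_(0 <= k < n) u k - l) < e.

Lemma num_sum_csum_to u l : csum_to u l -> num_sum u = l.
Proof.
move=> ul; apply: num_sum_eps => -[e e']; rewrite ltcE /= => /andP[/eqP -> e0].
have [N uN] := ul _ e0; exists N => n /uN.
set s := _ - l => sl.
by change ((((cmod s)%:C)%C : C) < (e%:C)%C); rewrite ltcR.
Qed.

Lemma csum_to_uniq u l l' : csum_to u l -> csum_to u l' -> l = l'.
Proof. by move=> /num_sum_csum_to <- /num_sum_csum_to <-. Qed.

Lemma csum_to_ex u : bounded_sums (fun n => cmod (u n)) -> exists l, csum_to u l.
Proof.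
move=> [M uM].
have abs (f : C -> R) : (forall z, `|f z| <= cmod z) ->
    cvgn (series (fun n => f (u n))).
  move=> fz; apply: normed_cvg; apply: nondecreasing_is_cvgn.
    apply/nondecreasing_seqP => n.
    change (\sum_(0 <= k < n) `|f (u k)| <= \sum_(0 <= k < n.+1) `|f (u k)|).
    by rewrite big_nat_recr //= lerDl.
  exists M => _ [n _ <-]; apply: le_trans (uM n).
  by apply: ler_sum => k _; exact: fz.
have /cvg_ex [x cRe] := abs _ normr_Re_le_cmod.
have /cvg_ex [y cIm] := abs _ normr_Im_le_cmod.
exists (Complex x y) => e e0; have e20 : 0 < e / 2 by rewrite divr_gt0.
move/cvgrPdist_lt : cRe => /(_ _ e20) [N1 _ H1].
move/cvgrPdist_lt : cIm => /(_ _ e20) [N2 _ H2].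
exists (maxn N1 N2) => n; rewrite geq_max => /andP[/H1 /= h1 /H2 /= h2].
have {}h1 : `|x - complex.Re (\sum_(0 <= k < n) u k)| < e / 2 by rewrite Re_sum.
have {}h2 : `|y - complex.Im (\sum_(0 <= k < n) u k)| < e / 2 by rewrite Im_sum.
apply: le_lt_trans (cmod_le_ReIm _) _; rewrite (splitr e).
move: h1 h2; case: (\sum_(0 <= k < n) u k) => s t /= h1 h2.
by apply: ltrD; rewrite distrC.
Qed.

Lemma csum_toB u v l l' : csum_to u l -> csum_to v l' ->
  csum_to (fun n => u n - v n) (l - l').
Proof.
move=> ul vl e e0; have e20 : 0 < e / 2 by rewrite divr_gt0.
have [N1 H1] := ul _ e20; have [N2 H2] := vl _ e20.
exists (maxn N1 N2) => n; rewrite geq_max => /andP[/H1 h1 /H2 h2].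
move: h1 h2; rewrite sumrB; set s := \sum_(0 <= k < n) _; set t := \sum_(0 <= k < n) _ => h1 h2.
rewrite (_ : s - t - (l - l') = (s - l) - (t - l')); last by ring.
by rewrite (le_lt_trans (le_cmodB _ _)) // (splitr e) ltrD.
Qed.

Lemma csum_to_finite u N : (forall n, (N <= n)%N -> u n = 0) ->
  csum_to u (\sum_(0 <= k < N) u k).
Proof.
move=> u0 e e0; exists N => n Nn.
rewrite [X in X - _](big_cat_nat _ (n := N)) //= addrAC subrr add0r.
by rewrite big_nat big1 ?cmod0 // => i /andP[/u0].
Qed.

Lemma csum_to_le u l M : csum_to u l ->
  (forall n, cmod (\sum_(0 <= k < n) u k) <= M) -> cmod l <= M.
Proof.
move=> ul uM; apply/ler_addgt0Pr => e e0; have [N /(_ _ (leqnn N)) uN] := ul _ e0.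
rewrite -(subKr (\sum_(0 <= k < N) u k) l) (le_trans (le_cmodB _ _)) //.
by rewrite lerD // ltW.
Qed.

(** Lower and upper bounds on [x + z s_n], for partial sums [s_n], pass to the
    limit. *)
Lemma csum_to_affine_ge u l x z N M : csum_to u l ->
  (forall n, (N <= n)%N -> M <= cmod (x + z * \sum_(0 <= k < n) u k)) ->
  M <= cmod (x + z * l).
Proof.
move=> ul uM; apply/ler_addgt0Pr => e e0.
have z1 : 0 < cmod z + 1 by rewrite ltr_wpDl ?cmod_ge0.
have [N' uN] := ul (e / (cmod z + 1)) (divr_gt0 e0 z1).
have := uM (maxn N N') (leq_maxl _ _); have {uN} := uN (maxn N N') (leq_maxr _ _).
set s := \sum_(0 <= k < _) _ => sl /le_trans; apply.
rewrite (_ : x + z * s = (x + z * l) + z * (s - l)); last by ring.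
apply: le_trans (le_cmodD _ _) _; rewrite lerD2l cmodM.
apply: (@le_trans _ _ (cmod z * (e / (cmod z + 1)))).
  by rewrite ler_wpM2l ?cmod_ge0 // ltW.
by rewrite mulrCA ler_piMr ?(ltW e0) // ler_pdivrMr // mul1r lerDl.
Qed.

Lemma csum_to_affine_le u l x z M : csum_to u l ->
  (forall n, cmod (x + z * \sum_(0 <= k < n) u k) <= M) ->
  cmod (x + z * l) <= M.
Proof.
move=> ul uM; apply/ler_addgt0Pr => e e0.
have z1 : 0 < cmod z + 1 by rewrite ltr_wpDl ?cmod_ge0.
have [N /(_ _ (leqnn N))] := ul (e / (cmod z + 1)) (divr_gt0 e0 z1).
have := uM N; set s := \sum_(0 <= k < _) _ => sM sl.
rewrite (_ : x + z * l = (x + z * s) - z * (s - l)); last by ring.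
apply: le_trans (le_cmodB _ _) _; rewrite lerD // cmodM.
apply: (@le_trans _ _ (cmod z * (e / (cmod z + 1)))).
  by rewrite ler_wpM2l ?cmod_ge0 // ltW.
by rewrite mulrCA ler_piMr ?(ltW e0) // ler_pdivrMr // mul1r lerDl.
Qed.

End ComplexSeries.

(** * Variation of constants and the energy identity *)

Section CanonicalSystem.
Context {R : realType}.
Local Notation C := R[i].
Local Open Scope complex_scope.
Variables a b : nat -> R.
Hypothesis b_gt0 : forall n, 0 < b n.

(** Real solution of the recurrence at spectral parameter 0 with prescribed
    first two terms. *)
Fixpoint real_sol (u0 u1 : R) (n : nat) {struct n} : R :=
  match n with
  | 0 => u0
  | n'.+1 =>
    match n' with
    | 0 => u1
    | m.+1 => (- a n' * real_sol u0 u1 n' - b m * real_sol u0 u1 m) / b n'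
    end
  end.

Lemma real_sol_rec u0 u1 n :
  b n.+1 * real_sol u0 u1 n.+2 + a n.+1 * real_sol u0 u1 n.+1
    + b n * real_sol u0 u1 n = 0.
Proof. by rewrite /=; field; rewrite gt_eqF. Qed.

Lemma jacobi_sol_real u0 u1 n :
  jacobi_sol a b 0 u0%:C u1%:C n = (real_sol u0 u1 n)%:C.
Proof.
suff : jacobi_sol a b 0 u0%:C u1%:C n = (real_sol u0 u1 n)%:C /\
    jacobi_sol a b 0 u0%:C u1%:C n.+1 = (real_sol u0 u1 n.+1)%:C by case.
elim: n => [//|n [IH IH']]; split => //.
rewrite [LHS]/= -/(jacobi_sol a b 0 u0%:C u1%:C n.+1) IH IH'.
by rewrite sub0r -rmorphN -!rmorphM -rmorphB -fmorph_div.
Qed.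

(** The values at 0 of the orthogonal polynomials of the first and second
    kind, as real numbers. *)
Definition p0 : nat -> R := real_sol 1 (- a 0%N / b 0%N).
Definition q0 : nat -> R := real_sol 0 (b 0%N)^-1.

Lemma orthopoly1_0 n : orthopoly1 a b n 0 = (p0 n)%:C.
Proof.
rewrite /orthopoly1 -jacobi_sol_real; congr jacobi_sol.
by rewrite sub0r -rmorphN -fmorph_div.
Qed.

Lemma orthopoly2_0 n : orthopoly2 a b n 0 = (q0 n)%:C.
Proof.
rewrite /orthopoly2 -jacobi_sol_real; congr jacobi_sol.
by rewrite fmorphV div1r.
Qed.

(** The Wronskian of the two solutions is constant. *)
Lemma wronskian n : b n * (q0 n.+1 * p0 n - p0 n.+1 * q0 n) = 1.
Proof.
elim: n => [|n IHn].
  by rewrite /q0 /p0 /=; field; rewrite gt_eqF.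
have bn := b_gt0 n.+1.
have rp := real_sol_rec 1 (- a 0%N / b 0%N) n; rewrite -/p0 in rp.
have rq := real_sol_rec 0 (b 0%N)^-1 n; rewrite -/q0 in rq.
move: (p0 n.+2) (q0 n.+2) rp rq => p2 q2 rp rq.
have {}rp : b n.+1 * p2 = - (a n.+1 * p0 n.+1) - b n * p0 n.
  by apply/eqP; rewrite -subr_eq0 -rp; apply/eqP; ring.
have {}rq : b n.+1 * q2 = - (a n.+1 * q0 n.+1) - b n * q0 n.
  by apply/eqP; rewrite -subr_eq0 -rq; apply/eqP; ring.
by rewrite mulrBr !mulrA rp rq -[RHS]IHn; ring.
Qed.

(** Variation of constants: every solution at spectral parameter [z] is a
    combination [- X_n p0 + Y_n q0] whose coefficients obey the first-order
    system below. The columns of the Nevanlinna matrix are the limits of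
    [(X_n, Y_n)] for the initial values [(-1, 0)] and [(0, 1)]. *)
Section FixedParameter.
Variables (z : C) (x0 y0 : R).

Fixpoint coeffs (n : nat) : C * C :=
  if n is m.+1 then
    let u := - (coeffs m).1 * (p0 m)%:C + (coeffs m).2 * (q0 m)%:C in
    ((coeffs m).1 + z * (q0 m)%:C * u, (coeffs m).2 + z * (p0 m)%:C * u)
  else (x0%:C, y0%:C).

(** The coefficients, and the solution at [z] that they represent. *)
Definition coeffX n := (coeffs n).1.
Definition coeffY n := (coeffs n).2.
Definition csol n : C := - coeffX n * (p0 n)%:C + coeffY n * (q0 n)%:C.

Lemma coeffXS n : coeffX n.+1 = coeffX n + z * (q0 n)%:C * csol n.
Proof. by []. Qed.

Lemma coeffYS n : coeffY n.+1 = coeffY n + z * (p0 n)%:C * csol n.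
Proof. by []. Qed.

(** The increments of [X] and [Y] cancel in index [n]. *)
Lemma csolE n : csol n = - coeffX n.+1 * (p0 n)%:C + coeffY n.+1 * (q0 n)%:C.
Proof. rewrite coeffXS coeffYS {1}/csol; ring. Qed.

Lemma coeffX_sum n :
  coeffX n = x0%:C + z * \sum_(0 <= k < n) (q0 k)%:C * csol k.
Proof.
elim: n => [|n IHn]; first by rewrite big_geq // mulr0 addr0.
rewrite coeffXS IHn big_nat_recr //=; ring.
Qed.

Lemma coeffY_sum n :
  coeffY n = y0%:C + z * \sum_(0 <= k < n) (p0 k)%:C * csol k.
Proof.
elim: n => [|n IHn]; first by rewrite big_geq // mulr0 addr0.
rewrite coeffYS IHn big_nat_recr //=; ring.
Qed.

Lemma csol_rec n :
  (b n.+1)%:C * csol n.+2 + (a n.+1)%:C * csol n.+1 + (b n)%:C * csol n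
  = z * csol n.+1.
Proof.
have rp : (b n.+1)%:C * (p0 n.+2)%:C + (a n.+1)%:C * (p0 n.+1)%:C
    + (b n)%:C * (p0 n)%:C = 0.
  by rewrite -3!rmorphM -2!rmorphD /p0 real_sol_rec.
have rq : (b n.+1)%:C * (q0 n.+2)%:C + (a n.+1)%:C * (q0 n.+1)%:C
    + (b n)%:C * (q0 n)%:C = 0.
  by rewrite -3!rmorphM -2!rmorphD /q0 real_sol_rec.
have w : (b n.+1)%:C * ((q0 n.+2)%:C * (p0 n.+1)%:C - (p0 n.+2)%:C * (q0 n.+1)%:C) = 1.
  by rewrite -2!rmorphM -rmorphB -rmorphM wronskian.
have e2 : csol n.+2 = - (coeffX n.+1 + z * (q0 n.+1)%:C * csol n.+1) * (p0 n.+2)%:C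
    + (coeffY n.+1 + z * (p0 n.+1)%:C * csol n.+1) * (q0 n.+2)%:C by [].
have e1 : csol n.+1 = - coeffX n.+1 * (p0 n.+1)%:C + coeffY n.+1 * (q0 n.+1)%:C by [].
have e0 := csolE n.
move: (csol n.+2) (csol n.+1) (csol n) (coeffX n.+1) (coeffY n.+1) e0 e1 e2.
move: (p0 n.+2) (q0 n.+2) (p0 n.+1) (q0 n.+1) rp rq w.
move=> p2 q2 p1 q1 rp rq w u2 u1 u X Y -> e1 ->.
have -> : (a n.+1)%:C * u1 = (a n.+1)%:C * (- X * p1%:C + Y * q1%:C) by rewrite -e1.
rewrite -[RHS]mulr1 -w; apply/eqP; rewrite -subr_eq0; apply/eqP.
transitivity (- X * ((b n.+1)%:C * p2%:C + (a n.+1)%:C * p1%:C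
    + (b n)%:C * (p0 n)%:C) + Y * ((b n.+1)%:C * q2%:C
    + (a n.+1)%:C * q1%:C + (b n)%:C * (q0 n)%:C)); first ring.
by rewrite rp rq !mulr0 addr0.
Qed.

Lemma jacobi_sol_csol n : jacobi_sol a b z (csol 0) (csol 1) n = csol n.
Proof.
suff : jacobi_sol a b z (csol 0) (csol 1) n = csol n /\
    jacobi_sol a b z (csol 0) (csol 1) n.+1 = csol n.+1 by case.
elim: n => [//|n [IH IH']]; split => //.
rewrite [LHS]/= -/(jacobi_sol a b z (csol 0) (csol 1) n.+1) IH IH'.
have bn : (b n.+1)%:C != 0 by rewrite fmorph_eq0 gt_eqF.
apply: (mulIf bn); rewrite divfK //.
apply/eqP; rewrite -subr_eq0 mulrBl -csol_rec; apply/eqP; ring.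
Qed.

Lemma Im_step (x y w : C) (s t : R) :
  let u := - x * s%:C + y * t%:C in
  complex.Im ((x + w * t%:C * u) * conjc (y + w * s%:C * u))
  = complex.Im (x * conjc y) + complex.Im w * cmod u ^+ 2.
Proof.
rewrite /= sqr_cmod; case: x y w => [x1 x2] [y1 y2] [w1 w2].
rewrite /real_complex_def /=; ring.
Qed.

Lemma Im_wronskian (x y : C) (s t s' t' : R) :
  complex.Im ((- x * s'%:C + y * t'%:C) * conjc (- x * s%:C + y * t%:C))
  = complex.Im (x * conjc y) * (t' * s - s' * t).
Proof.
case: x y => [x1 x2] [y1 y2]; rewrite /real_complex_def /=; ring.
Qed.

(** Partial sums of the squared moduli of the solution. *)
Definition sqsum n : R := \sum_(0 <= k < n) cmod (csol k) ^+ 2.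

Lemma sqsum_ge0 n : 0 <= sqsum n.
Proof. by apply: sumr_ge0 => k _; rewrite sqr_ge0. Qed.

Lemma sqsum_le m n : (m <= n)%N -> sqsum m <= sqsum n.
Proof.
move=> mn; rewrite /sqsum [leRHS](big_cat_nat _ (n := m)) //= lerDl.
by apply: sumr_ge0 => k _; rewrite sqr_ge0.
Qed.

(** The imaginary part of [X_n] times the conjugate of [Y_n] measures the
    squared norm of the solution up to index [n]. *)
Lemma Im_coeffs n :
  complex.Im (coeffX n * conjc (coeffY n)) = complex.Im z * sqsum n.
Proof.
elim: n => [|n IHn]; first by rewrite /sqsum big_geq //=; ring.
rewrite coeffXS coeffYS Im_step -/(csol n) IHn /sqsum big_nat_recr //=.
by rewrite mulrDr.
Qed.

Lemma Im_csol n :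
  b n * complex.Im (csol n.+1 * conjc (csol n)) = complex.Im z * sqsum n.+1.
Proof.
rewrite {1}/csol (csolE n) Im_wronskian mulrCA wronskian mulr1.
exact: Im_coeffs.
Qed.

(** Size of the [k]-th step of the system for [(X, Y)], up to the factor
    [|z|]. *)
Definition transfer_weight k : R := (`|p0 k| + `|q0 k|) ^+ 2.
Definition coeff_size n : R := cmod (coeffX n) + cmod (coeffY n).

Lemma coeff_size0 : coeff_size 0 = `|x0| + `|y0|.
Proof. by rewrite -!cmod_real. Qed.

Lemma cmod_csol_le n : cmod (csol n) <= coeff_size n * (`|p0 n| + `|q0 n|).
Proof.
apply: le_trans (le_cmodD _ _) _; rewrite !cmodM cmodN !cmod_real.
by rewrite mulrDr lerD // ler_wpM2r ?lerDl ?lerDr ?cmod_ge0.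
Qed.

Lemma coeff_sizeS n :
  coeff_size n.+1 <= coeff_size n * (1 + cmod z * transfer_weight n).
Proof.
apply: (@le_trans _ _ (coeff_size n +
    cmod z * (`|p0 n| + `|q0 n|) * cmod (csol n))).
  have hx : cmod (coeffX n.+1) <= cmod (coeffX n) + cmod z * `|q0 n| * cmod (csol n).
    by rewrite coeffXS (le_trans (le_cmodD _ _)) // !cmodM cmod_real.
  have hy : cmod (coeffY n.+1) <= cmod (coeffY n) + cmod z * `|p0 n| * cmod (csol n).
    by rewrite coeffYS (le_trans (le_cmodD _ _)) // !cmodM cmod_real.
  apply: (le_trans (lerD hx hy)); rewrite le_eqVlt; apply/orP; left.
  by apply/eqP; rewrite /coeff_size; ring.
rewrite [leRHS]mulrDr mulr1 lerD2l /transfer_weight [leRHS]mulrCA -mulrA.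
rewrite ler_wpM2l ?cmod_ge0 // [leLHS]mulrC expr2 mulrA.
by rewrite ler_wpM2r ?addr_ge0 ?cmod_csol_le.
Qed.

End FixedParameter.
End CanonicalSystem.

(** * Bounds for the coefficients and their limits *)

Section Growth.
Context {R : realType}.
Local Notation C := R[i].
Local Open Scope complex_scope.
Variables (a b : nat -> R) (K : R).
Hypothesis b_gt0 : forall n, 0 < b n.
Hypothesis sum_invb : bounded_sums (fun n => (b n)^-1).
Hypothesis weight_le : forall n, b n * transfer_weight a b n <= K.

Local Notation p0 := (p0 a b).
Local Notation q0 := (q0 a b).
Local Notation coeffX := (coeffX a b).
Local Notation coeffY := (coeffY a b).
Local Notation csol := (csol a b).
Local Notation sqsum := (sqsum a b).
Local Notation coeff_size := (coeff_size a b).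
Local Notation transfer_weight := (transfer_weight a b).

Lemma transfer_weight_ge0 n : 0 <= transfer_weight n.
Proof. exact: sqr_ge0. Qed.

Lemma weight_bound_ge0 : 0 <= K.
Proof.
by apply: le_trans (weight_le 0); rewrite mulr_ge0 ?(ltW (b_gt0 _)) ?sqr_ge0.
Qed.

Lemma sum_transfer_weight : bounded_sums transfer_weight.
Proof.
apply: (@bounded_sums_le _ _ (fun n => (b n)^-1) K 0) => [n||n _|n|//].
- exact: transfer_weight_ge0.
- exact: weight_bound_ge0.
- by rewrite ler_pdivlMr // mulrC.
- by rewrite invr_ge0 ltW.
Qed.

(** Gronwall: [|X_n| + |Y_n|] is at most its initial value times the product
    of the factors [1 + |z| transfer_weight k], and these weights are
    [O(1 / b_k)]. *)
Lemma coeff_size_le (al S : R) : 0 < al <= 1 ->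
  (forall n, \sum_(0 <= k < n) b k `^ (- al) <= S) ->
  forall z x0 y0 n, coeff_size z x0 y0 n <=
    (`|x0| + `|y0|) * expR (cmod z `^ al * (K `^ al / al * S)).
Proof.
move=> al01 bS z x0 y0 n; have /andP[al0 _] := al01.
have K0 := weight_bound_ge0.
apply: (@le_trans _ _ ((`|x0| + `|y0|) *
    expR (\sum_(0 <= k < n) cmod z `^ al * (K `^ al / al * b k `^ (- al))))).
  elim: n => [|n IHn].
    by rewrite big_geq // expR0 mulr1 coeff_size0.
  rewrite big_nat_recr //= expRD [leRHS]mulrA (le_trans (coeff_sizeS _ _ _ _ _ _)) //.
  apply: ler_pM; rewrite ?addr_ge0 ?mulr_ge0 ?cmod_ge0 ?transfer_weight_ge0 //.
  apply: (le_trans (ln1D_le_powR al01 _)).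
    by rewrite mulr_ge0 ?cmod_ge0 ?transfer_weight_ge0.
  rewrite ler_expR powRM ?cmod_ge0 ?transfer_weight_ge0 // -mulrA.
  rewrite ler_wpM2l ?powR_ge0 // mulrAC ler_wpM2r ?invr_ge0 ?(ltW al0) //.
  rewrite powRN ler_pdivlMr ?powR_gt0 // mulrC -powRM ?transfer_weight_ge0 ?(ltW (b_gt0 _)) //.
  rewrite ge0_ler_powR ?nnegrE ?(ltW al0) ?weight_le //.
  by rewrite mulr_ge0 ?transfer_weight_ge0 ?(ltW (b_gt0 _)).
rewrite ler_wpM2l ?addr_ge0 // ler_expR -mulr_sumr ler_wpM2l ?powR_ge0 //.
by rewrite -mulr_sumr ler_wpM2l ?divr_ge0 ?powR_ge0 ?(ltW al0).
Qed.

Lemma coeff_size_bounded z x0 y0 :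
  exists2 T, 0 <= T & forall n, coeff_size z x0 y0 n <= T.
Proof.
have [S bS] := sum_invb.
have bS' n : \sum_(0 <= k < n) b k `^ (- 1) <= S.
  by under eq_bigr do rewrite powRN powRr1 ?(ltW (b_gt0 _)) //.
eexists; last by apply: (coeff_size_le _ bS'); rewrite ltr01 lexx.
by rewrite mulr_ge0 ?expR_ge0 ?addr_ge0.
Qed.

Lemma sqr_csol_summable z x0 y0 :
  bounded_sums (fun n => cmod (csol z x0 y0 n) ^+ 2).
Proof.
have [T T0 hT] := coeff_size_bounded z x0 y0.
apply: (@bounded_sums_le _ _ transfer_weight (T ^+ 2) 0) => [n||n _|n|].
- exact: sqr_ge0.
- exact: sqr_ge0.
- rewrite -exprMn ler_pXn2r ?nnegrE ?cmod_ge0 ?mulr_ge0 ?addr_ge0 //.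
  apply: le_trans (cmod_csol_le _ _ _ _ _ _) _.
  by rewrite ler_wpM2r ?addr_ge0.
- exact: transfer_weight_ge0.
- exact: sum_transfer_weight.
Qed.

Lemma mul_csol_summable (w : nat -> R) z x0 y0 :
  (forall n, `|w n| <= `|p0 n| + `|q0 n|) ->
  bounded_sums (fun n => cmod ((w n)%:C * csol z x0 y0 n)).
Proof.
move=> wpq; have [T T0 hT] := coeff_size_bounded z x0 y0.
apply: (@bounded_sums_le _ _ transfer_weight T 0) => [n||n _|n|] //.
- exact: cmod_ge0.
- rewrite cmodM cmod_real /transfer_weight expr2 mulrCA ler_pM ?cmod_ge0 //.
  apply: le_trans (cmod_csol_le _ _ _ _ _ _) _.
  by rewrite ler_wpM2r ?addr_ge0.
- exact: transfer_weight_ge0.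
- exact: sum_transfer_weight.
Qed.

(** The limits of [X_n] and [Y_n] as functions of [z]. *)
Definition limX z x0 y0 : C :=
  x0%:C + z * num_sum (fun n => (q0 n)%:C * csol z x0 y0 n).
Definition limY z x0 y0 : C :=
  y0%:C + z * num_sum (fun n => (p0 n)%:C * csol z x0 y0 n).

Lemma num_sum_mul_csol (w : nat -> R) z x0 y0 :
  (forall n, `|w n| <= `|p0 n| + `|q0 n|) ->
  csum_to (fun n => (w n)%:C * csol z x0 y0 n)
    (num_sum (fun n => (w n)%:C * csol z x0 y0 n)).
Proof.
move=> wpq; have [l ul] := csum_to_ex (mul_csol_summable z x0 y0 wpq).
by rewrite (num_sum_csum_to ul).
Qed.

Let q0_le n : `|q0 n| <= `|p0 n| + `|q0 n|.
Proof. by rewrite lerDr. Qed.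

Let p0_le n : `|p0 n| <= `|p0 n| + `|q0 n|.
Proof. by rewrite lerDl. Qed.

Lemma limX_le z x0 y0 M : (forall n, coeff_size z x0 y0 n <= M) ->
  cmod (limX z x0 y0) <= M.
Proof.
move=> hM; apply: (csum_to_affine_le (num_sum_mul_csol _ _ _ q0_le)) => n.
by rewrite -coeffX_sum (le_trans _ (hM n)) // lerDl cmod_ge0.
Qed.

Lemma limY_le z x0 y0 M : (forall n, coeff_size z x0 y0 n <= M) ->
  cmod (limY z x0 y0) <= M.
Proof.
move=> hM; apply: (csum_to_affine_le (num_sum_mul_csol _ _ _ p0_le)) => n.
by rewrite -coeffY_sum (le_trans _ (hM n)) // lerDr cmod_ge0.
Qed.

Section ImaginaryAxis.
Variables (y x0 y0 s0 : R).
Hypotheses (y1 : 1 <= y) (x0_le : `|x0| <= 1) (y0_le : `|y0| <= 1).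
Let z : C := 0 +i* y.
Hypotheses (s0_gt0 : 0 < s0) (s0_le : s0 <= sqsum z x0 y0 2).
Local Notation S := (sqsum z x0 y0).

Let y_gt0 : 0 < y. Proof. exact: lt_le_trans ltr01 y1. Qed.

Let cmod_z : cmod z = y.
Proof. by rewrite /cmod /= expr0n add0r sqrtr_sqr ger0_norm // ltW. Qed.

(** Since [b_n |u_n| |u_(n+1)|] dominates [y S_(n+1)] by [Im_csol], two steps
    multiply the partial sums by at least [1 + 2 y / b_n]. *)
Lemma sqsum_growth n : S n * (1 + 2 * y / b n) <= S n.+2.
Proof.
have bn := b_gt0 n.
have h : y / b n * S n.+1 <= cmod (csol z x0 y0 n.+1) * cmod (csol z x0 y0 n).
  rewrite mulrAC ler_pdivrMr // [leRHS]mulrC.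
  have := Im_csol a b_gt0 z x0 y0 n; rewrite [complex.Im z]/= => <-.
  rewrite ler_wpM2l ?(ltW bn) // -[cmod (csol z x0 y0 n)]cmod_conjc -cmodM.
  exact: le_trans (ler_norm _) (normr_Im_le_cmod _).
have -> : S n.+2 = S n + (cmod (csol z x0 y0 n) ^+ 2 + cmod (csol z x0 y0 n.+1) ^+ 2).
  by rewrite /sqsum !big_nat_recr //= addrA.
rewrite mulrDr mulr1 lerD2l.
have yb : 0 < y / b n by rewrite divr_gt0.
have SS : y / b n * S n <= y / b n * S n.+1 by rewrite ler_wpM2l ?(ltW yb) ?sqsum_le.
have -> : S n * (2 * y / b n) = 2 * (y / b n * S n) by ring.
have := sqr_ge0 (cmod (csol z x0 y0 n.+1) - cmod (csol z x0 y0 n)).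
move: h SS; rewrite sqrrB; lra.
Qed.

Lemma sqsum_prod n : (2 <= n)%N ->
  s0 ^+ 2 * \prod_(2 <= k < n) (1 + 2 * y / b k) <= S n * S n.+1.
Proof.
have s0' := ltW s0_gt0.
elim: n => // n IHn; rewrite leq_eqVlt => /predU1P[<-|n2].
  rewrite big_geq // mulr1 expr2 ler_pM //.
  by apply: (le_trans s0_le); exact: sqsum_le.
rewrite big_nat_recr //= mulrA.
have yb : 0 <= 1 + 2 * y / b n.
  by rewrite addr_ge0 // divr_ge0 ?mulr_ge0 ?(ltW y_gt0) ?(ltW (b_gt0 _)).
apply: (@le_trans _ _ (S n * S n.+1 * (1 + 2 * y / b n))).
  by rewrite ler_wpM2r ?IHn.
by rewrite mulrAC [leRHS]mulrC ler_wpM2r ?sqsum_growth ?sqsum_ge0.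
Qed.

Let S_gt0 n : (2 <= n)%N -> 0 < S n.
Proof.
by move=> n2; apply: lt_le_trans s0_gt0 (le_trans s0_le _); exact: sqsum_le.
Qed.

(** Cauchy-Schwarz, by a weighted arithmetic-geometric mean inequality. *)
Lemma affine_sum_le (w : nat -> R) W x1 n : (2 <= n)%N -> `|x1| <= 1 ->
  (forall n, \sum_(0 <= k < n) w k ^+ 2 <= W) ->
  cmod (x1%:C + z * \sum_(0 <= k < n) (w k)%:C * csol z x0 y0 k) <=
    y * ((Num.sqrt s0)^-1 + (W + 1) / 2) * Num.sqrt (S n).
Proof.
move=> n2 x11 wW; set s := Num.sqrt (S n).
have s_gt0 : 0 < s by rewrite sqrtr_gt0 S_gt0.
have ss : s ^+ 2 = S n by rewrite sqr_sqrtr // sqsum_ge0.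
have sum_le : cmod (\sum_(0 <= k < n) (w k)%:C * csol z x0 y0 k) <= (W + 1) / 2 * s.
  apply: (le_trans (le_cmod_sum _ _)).
  apply: (@le_trans _ _ (\sum_(0 <= k < n)
     (s / 2 * w k ^+ 2 + s^-1 / 2 * cmod (csol z x0 y0 k) ^+ 2))).
    apply: ler_sum => k _; rewrite cmodM cmod_real.
    set v := cmod _; rewrite -(real_normK (num_real (w k))); set t := `|w k|.
    have -> : s / 2 * t ^+ 2 + s^-1 / 2 * v ^+ 2
        = t * v + s^-1 / 2 * (s * t - v) ^+ 2 by field; rewrite gt_eqF.
    by rewrite lerDl mulr_ge0 ?sqr_ge0 // divr_ge0 // invr_ge0 ltW.
  rewrite big_split /= -!mulr_sumr -/(sqsum _ _ _ _) -/(S n) -ss.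
  have -> : s^-1 / 2 * s ^+ 2 = s / 2 by field; rewrite gt_eqF.
  have := wW n; set w2 := \sum_(0 <= k < n) _ => w2W; nra.
apply: le_trans (le_cmodD _ _) _; rewrite cmodM cmod_z cmod_real.
have -> : y * ((Num.sqrt s0)^-1 + (W + 1) / 2) * s =
  y * ((Num.sqrt s0)^-1 * s) + y * ((W + 1) / 2 * s) by ring.
apply: lerD; last by rewrite ler_wpM2l // ltW.
apply: (le_trans x11); rewrite -[leLHS]mul1r ler_pM //.
rewrite ler_pdivlMl ?sqrtr_gt0 // mulr1 ler_wsqrtr //.
by apply: (le_trans s0_le); exact: sqsum_le.
Qed.

(** As [y S_n <= |X| |Y|], an upper bound for one coefficient is a lower bound
    for the other. *)
Lemma cmod_coeff_ge (X Y : C) L n : (2 <= n)%N ->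
  complex.Im (X * conjc Y) = y * S n -> 0 <= L ->
  cmod Y <= y * L * Num.sqrt (S n) -> Num.sqrt (S n) <= L * cmod X.
Proof.
move=> n2 XY L0 YL; set s := Num.sqrt (S n) in YL *.
have s_gt0 : 0 < s by rewrite sqrtr_gt0 S_gt0.
have ss : s ^+ 2 = S n by rewrite sqr_sqrtr // sqsum_ge0.
have : y * s ^+ 2 <= y * s * (L * cmod X).
  rewrite ss -XY; apply: (le_trans (ler_norm _)).
  apply: le_trans (normr_Im_le_cmod _) _; rewrite cmodM cmod_conjc.
  apply: le_trans (_ : cmod X * (y * L * s) <= _).
    by rewrite ler_wpM2l ?cmod_ge0.
  by rewrite le_eqVlt; apply/orP; left; apply/eqP; ring.
by rewrite expr2 mulrA ler_pM2l // mulr_gt0.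
Qed.

Lemma prod_le_of_sqrt (L m : R) N : (2 <= N)%N -> 0 < L -> 0 <= m ->
  Num.sqrt (S N.+1) <= L * m ->
  s0 ^+ 2 / L ^+ 4 * \prod_(2 <= k < N) (1 + 2 * y / b k) <= m ^+ 4.
Proof.
move=> N2 L0 m0 sm; rewrite mulrAC ler_pdivrMr ?exprn_gt0 //.
apply: (le_trans (sqsum_prod N2)).
apply: (@le_trans _ _ (S N.+1 ^+ 2)).
  by rewrite expr2 ler_wpM2r ?sqsum_ge0 ?sqsum_le.
rewrite -exprMn mulrC (exprM _ 2 2) ler_pXn2r ?nnegrE ?sqsum_ge0 ?sqr_ge0 //.
rewrite -[leLHS]sqr_sqrtr ?sqsum_ge0 // ler_pXn2r ?nnegrE ?sqrtr_ge0 //.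
by rewrite mulr_ge0 // ltW.
Qed.

Let sum_sqr_le (w : nat -> R) (W : R) :
  (forall n, `|w n| <= `|p0 n| + `|q0 n|) ->
  (forall n, \sum_(0 <= k < n) transfer_weight k <= W) ->
  forall n, \sum_(0 <= k < n) w k ^+ 2 <= W.
Proof.
move=> wpq hW n; apply: le_trans (hW n); apply: ler_sum => k _.
by rewrite -(real_normK (num_real (w k))) ler_pXn2r ?nnegrE ?addr_ge0.
Qed.

Lemma lim_coeffs_lower_bound W (L := (Num.sqrt s0)^-1 + (W + 1) / 2) :
  (forall n, \sum_(0 <= k < n) transfer_weight k <= W) ->
  forall N, (2 <= N)%N ->
  s0 ^+ 2 / L ^+ 4 * \prod_(2 <= k < N) (1 + 2 * y / b k)
     <= cmod (limX z x0 y0) ^+ 4 /\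
  s0 ^+ 2 / L ^+ 4 * \prod_(2 <= k < N) (1 + 2 * y / b k)
     <= cmod (limY z x0 y0) ^+ 4.
Proof.
move=> hW N N2.
have W0 : 0 <= W by have := hW 0%N; rewrite big_geq.
have L0 : 0 < L by rewrite /L addr_gt0 ?divr_gt0 ?invr_gt0 ?sqrtr_gt0 // ltr_wpDl.
have N2' n : (N < n)%N -> (2 <= n)%N by move=> /ltnW; exact: leq_trans.
have sS n : (N < n)%N -> Num.sqrt (S N.+1) <= Num.sqrt (S n).
  by move=> Nn; rewrite ler_wsqrtr // sqsum_le.
have imz : complex.Im z = y by [].
split; apply: prod_le_of_sqrt; rewrite ?cmod_ge0 // -ler_pdivrMl //.
  apply: (csum_to_affine_ge (N := N.+1) (num_sum_mul_csol _ _ _ q0_le)) => n Nn.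
  rewrite -coeffX_sum ler_pdivrMl //; apply: (le_trans (sS _ Nn)).
  apply: (@cmod_coeff_ge _ (coeffY z x0 y0 n)); rewrite ?N2' ?(ltW L0) //.
    by rewrite Im_coeffs.
  by rewrite coeffY_sum; apply: affine_sum_le; rewrite ?N2' //; exact: sum_sqr_le.
apply: (csum_to_affine_ge (N := N.+1) (num_sum_mul_csol _ _ _ p0_le)) => n Nn.
rewrite -coeffY_sum ler_pdivrMl //; apply: (le_trans (sS _ Nn)).
(* the roles of X and Y are exchanged by (X, Y) -> (Y, - X) *)
apply: (@cmod_coeff_ge _ (- coeffX z x0 y0 n)); rewrite ?N2' ?(ltW L0) //.
  rewrite -imz -(Im_coeffs a b z x0 y0 n).
  by case: (coeffX _ _ _ _) (coeffY _ _ _ _) => [x1 x2] [w1 w2] /=; ring.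
rewrite cmodN coeffX_sum; apply: affine_sum_le; rewrite ?N2' //.
exact: sum_sqr_le.
Qed.

End ImaginaryAxis.
End Growth.

(** * Maximum modulus, limits superior and dyadic summation *)

Section OrderOfGrowth.
Context {R : realType}.
Local Notation C := R[i].
Local Open Scope complex_scope.

Lemma limf_esup_le_near (f : R -> \bar R) (c : \bar R) (r0 : R) :
  (forall r, r0 < r -> (f r <= c)%E) -> (limf_esup f (pinfty_nbhs R) <= c)%E.
Proof.
move=> fc; rewrite limf_esupE.
apply: (@le_trans _ _ (ereal_sup [set f x | x in [set x | r0 < x]])).
  apply: ereal_inf_lbound; exists [set x | r0 < x] => //.
  by exists r0; split; [exact: num_real|].
by apply: ge_ereal_sup => _ [r /fc + <-].
Qed.

Lemma limf_esup_lt_near (f : R -> \bar R) (c : \bar R) :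
  (limf_esup f (pinfty_nbhs R) < c)%E ->
  exists r0, forall r, r0 < r -> (f r < c)%E.
Proof.
rewrite limf_esupE => /ereal_inf_lt [_ [V [r0 [_ r0V]] <-] supV].
exists r0 => r /r0V Vr; apply: le_lt_trans supV.
by apply: ereal_sup_ubound; exists r.
Qed.

Lemma limf_esup_ge_near (f : R -> \bar R) (c : \bar R) (r0 : R) :
  (forall r, r0 < r -> (c <= f r)%E) -> (c <= limf_esup f (pinfty_nbhs R))%E.
Proof.
move=> cf; rewrite leNgt; apply/negP => /limf_esup_lt_near [r1 fc].
have := fc (Num.max r0 r1 + 1); have := cf (Num.max r0 r1 + 1).
have r1_lt : r1 < Num.max r0 r1 + 1 by rewrite ltr_pwDr // le_max lexx orbT.
have r0_lt : r0 < Num.max r0 r1 + 1 by rewrite ltr_pwDr // le_max lexx.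
by move=> /(_ r0_lt) h /(_ r1_lt); rewrite ltNge h.
Qed.

Lemma max_modulus_le (w : C -> C) (r B : R) : 0 <= r ->
  (forall z, cmod z = r -> cmod (w z) <= B) -> max_modulus w r <= B.
Proof.
move=> r0 wB; apply: ge_sup => [|_ [z /wB + <-] //].
exists (cmod (w r%:C)), r%:C => //; exact: etrans (cmod_real r) (ger0_norm r0).
Qed.

Lemma le_max_modulus (w : C -> C) (z : C) (B : R) :
  (forall z', cmod z' = cmod z -> cmod (w z') <= B) ->
  cmod (w z) <= max_modulus w (cmod z).
Proof.
by move=> wB; apply: ub_le_sup; [exists B => _ [z' /wB + <-]|exists z].
Qed.

(* In the next two lemmas x may be nonpositive, where ln is 0. *)
Lemma ln_le_of_le_expR (x y : R) : 0 <= y -> x <= expR y -> ln x <= y.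
Proof.
move=> y0 xy; have [x0|x0] := leP x 0; first by rewrite ln0.
by rewrite -[leRHS]expRK ler_ln // posrE expR_gt0.
Qed.

Lemma ln_le_powR (x r al : R) : 0 < r -> ln x / ln r < al -> 0 < ln r ->
  x <= r `^ al.
Proof.
move=> r0 h lr; have [x0|x0] := leP x 0; first exact: le_trans x0 (powR_ge0 _ _).
rewrite -ler_ln ?posrE ?powR_gt0 // ln_powR.
by rewrite -ler_pdivrMr // ltW.
Qed.

Lemma sum_geometric_le (q : R) n : 0 <= q < 1 ->
  \sum_(0 <= j < n) q ^+ j <= (1 - q)^-1.
Proof.
move=> /andP[q0 q1]; have q1' : 0 < 1 - q by rewrite subr_gt0.
have -> : \sum_(0 <= j < n) q ^+ j = (1 - q ^+ n) / (1 - q).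
  elim: n => [|n IHn]; first by rewrite big_geq // expr0 subrr mul0r.
  by rewrite big_nat_recr //= IHn exprS; field; rewrite gt_eqF.
by rewrite ler_pdivrMr // mulVf ?gt_eqF // lerBlDr lerDl exprn_ge0.
Qed.

Lemma dyadic_bracket (x : R) j0 : 2 ^+ j0 <= x ->
  exists2 j, (j0 <= j)%N & 2 ^+ j <= x < 2 ^+ j.+1.
Proof.
move=> xj; have ex : exists j, x < 2 ^+ j.
  by exists (Num.bound x); exact: upper_nthrootP.
case: (ex_minnP ex) => -[|j] xlt jmin.
  have : x < 2 ^+ j0 by apply: lt_le_trans xlt _; rewrite ler_eXn2l ?ltr1n.
  by rewrite ltNge xj.
have xj' : 2 ^+ j <= x by rewrite leNgt; apply/negP => /jmin; rewrite ltnn.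
exists j; last by rewrite xj'.
by rewrite -ltnS -(@ltr_eXn2l R 2) ?ltr1n // (le_lt_trans xj).
Qed.

(** If [\sum_k ln (1 + 2 r / b_k)] is [O(r ^ al)], then the convergence exponent
    of [b] is at most [al]. The bounds at [r = 2 ^ j] are summed with weights
    [2 ^ (- j al')]; the term with [2 ^ j <= b_k < 2 ^ j.+1] alone dominates
    [b_k ^ (- al')]. *)
Lemma summable_of_log_product (b : nat -> R) (al al' K r1 : R) m :
  (forall n, 0 < b n) -> bounded_sums (fun n => (b n)^-1) ->
  0 < al -> al < al' ->
  (forall r N, r1 < r -> \sum_(m <= k < N) ln (1 + 2 * r / b k) <= K * r `^ al) ->
  bounded_sums (fun n => b n `^ (- al')).
Proof.
move=> b0 sb al0 alal' bnd.
set j0 := Num.bound r1.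
have r1j j : (j0 <= j)%N -> r1 < 2 ^+ j by exact: upper_nthrootP.
have p2 j : 0 < 2 ^+ j :> R by rewrite exprn_gt0.
have [N0 bN0] := bounded_sums_small (fun n => ltW (etrans (invr_gt0 _) (b0 n))) sb
  (etrans (invr_gt0 _) (p2 j0)).
pose N1 := maxn m N0.
have bj0 k : (N1 <= k)%N -> 2 ^+ j0 <= b k.
  rewrite geq_max => /andP[_ /bN0]; rewrite ltf_pV2 ?posrE // => /ltW.
  by [].
have l2 : 0 < ln 2 :> R by rewrite ln_gt0 // ltr1n.
pose q : R := 2 `^ (al - al').
have q01 : 0 <= q < 1.
  rewrite powR_ge0 /= -ltr_ln ?posrE ?powR_gt0 // ln_powR ln1.
  by rewrite pmulr_llt0 // subr_lt0.
have pw j (x : R) : (2 ^+ j) `^ x = (2 `^ x) ^+ j.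
  by rewrite -powR_mulrn // -powRrM mulrC powRrM powR_mulrn ?powR_ge0.
apply: (bounded_sums_tail (N := N1) (M := (ln 2)^-1 * (K * (1 - q)^-1))) => [n|n N1n].
  exact: powR_ge0.
(* 2 ^ J exceeds every b_k with k < n *)
pose J := Num.bound (\sum_(0 <= k < n) b k).
have K0 : 0 <= K.
  have := bnd (2 ^+ j0) m (r1j _ (leqnn _)); rewrite big_geq // => h.
  by move: h; rewrite pmulr_lge0 // powR_gt0.
have lnpos r k : 0 <= r -> 0 <= ln (1 + 2 * r / b k).
  by move=> r0; rewrite ln_ge0 // lerDl divr_ge0 ?mulr_ge0 ?(ltW (b0 _)).
have term k : (N1 <= k < n)%N -> b k `^ (- al') <=
    (ln 2)^-1 * \sum_(j0 <= j < J) (2 ^+ j) `^ (- al') * ln (1 + 2 * 2 ^+ j / b k).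
  move=> /andP[N1k kn]; have [j j0j /andP[jb bj]] := dyadic_bracket (bj0 _ N1k).
  have jJ : (j < J)%N.
    rewrite -(@ltr_eXn2l R 2) ?ltr1n //; apply: (le_lt_trans jb).
    apply: le_lt_trans (upper_nthrootP (leqnn J)).
    rewrite (bigD1_seq k) ?mem_index_iota ?iota_uniq //= lerDl.
    by apply: sumr_ge0 => i _; exact: ltW.
  rewrite (bigD1_seq j) ?mem_index_iota ?iota_uniq ?j0j //= mulrDr.
  rewrite -[leLHS]addr0 lerD //; last first.
    rewrite mulr_ge0 ?invr_ge0 ?(ltW l2) ?sumr_ge0 // => i _.
    by rewrite mulr_ge0 ?powR_ge0 ?lnpos ?(ltW (p2 _)).
  rewrite ler_pdivlMl // mulrC ler_pM ?powR_ge0 ?(ltW l2) //.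
    rewrite !powRN lef_pV2 ?posrE ?powR_gt0 //.
    by rewrite ge0_ler_powR ?nnegrE ?(ltW (p2 _)) ?(ltW (b0 _)) // ltW // (lt_trans al0).
  rewrite ler_ln ?posrE ?ltr_wpDr ?divr_ge0 ?mulr_ge0 ?(ltW (p2 _)) ?(ltW (b0 _)) //.
  rewrite -[leLHS]/(1 + 1) lerD2l ler_pdivlMr // mul1r -exprS; exact: ltW.
apply: (le_trans (ler_sum_nat term)); rewrite -mulr_sumr.
rewrite ler_wpM2l ?invr_ge0 ?(ltW l2) // exchange_big /=.
apply: (@le_trans _ _ (\sum_(j0 <= j < J) K * q ^+ j)).
  apply: ler_sum_nat => j /andP[j0j _]; rewrite -mulr_sumr.
  apply: (@le_trans _ _ ((2 ^+ j) `^ (- al') * (K * (2 ^+ j) `^ al))).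
    rewrite ler_wpM2l ?powR_ge0 //; apply: le_trans (bnd (2 ^+ j) n (r1j _ j0j)).
    have [N1m|//] := leqP m N1; last by rewrite ltnNge leq_maxl.
    rewrite [leRHS](big_cat_nat _ (n := N1)) //= lerDr sumr_ge0 // => k _.
    by rewrite lnpos ?(ltW (p2 _)).
  by rewrite mulrCA -powRD ?(gt_eqF (p2 _)) ?implybT // addrC pw.
rewrite -mulr_sumr ler_wpM2l //; apply: le_trans (sum_geometric_le J q01).
have [j0J|Jj0] := leqP j0 J; last first.
  rewrite big_geq ?(ltnW Jj0) // sumr_ge0 // => i _.
  by rewrite exprn_ge0 // powR_ge0.
rewrite [leRHS](big_cat_nat _ (n := j0)) //= lerDr sumr_ge0 // => i _.
by rewrite exprn_ge0 // powR_ge0.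
Qed.

End OrderOfGrowth.

(** * Order and type from product bounds *)

(** If [w] is bounded above everywhere, and below on the imaginary axis, in terms
    of [b] as follows, then its order is the convergence exponent of [b]. *)
Section OrderFromBounds.
Context {R : realType}.
Local Notation C := R[i].
Local Open Scope complex_scope.
Variables (b : nat -> R) (w : C -> C).
Hypothesis b_gt0 : forall n, 0 < b n.
Hypothesis sum_invb : bounded_sums (fun n => (b n)^-1).
Hypothesis w_upper : forall al, 0 < al <= 1 ->
  bounded_sums (fun n => b n `^ (- al)) ->
  exists2 K, 0 <= K & forall z, cmod (w z) <= expR (cmod z `^ al * K).
Hypothesis w_lower : exists2 c, 0 < c & forall y N, 1 <= y -> (2 <= N)%N ->
  c * \prod_(2 <= k < N) (1 + 2 * y / b k) <= cmod (w (0 +i* y)) ^+ 4.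

Lemma sum_powRN1 : bounded_sums (fun n => b n `^ (- 1)).
Proof.
have [S bS] := sum_invb; exists S => n.
by under eq_bigr do rewrite powR_inv1 ?(ltW (b_gt0 _)) //.
Qed.

Lemma ln_max_modulus_le al : 0 < al <= 1 ->
  bounded_sums (fun n => b n `^ (- al)) ->
  exists2 K, 0 <= K & forall r, 0 <= r -> ln (max_modulus w r) <= r `^ al * K.
Proof.
move=> al01 /(w_upper al01) [K K0 wK]; exists K => // r r0.
apply: ln_le_of_le_expR; first by rewrite mulr_ge0 ?powR_ge0.
by apply: max_modulus_le => // z <-.
Qed.

Lemma max_modulus_ge0 r : 0 <= r -> 0 <= max_modulus w r.
Proof.
move=> r0; have [|K _ wK] := @w_upper 1 _ sum_powRN1; first by rewrite ltr01 lexx.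
have zr : cmod (r%:C : C) = r by rewrite cmod_real ger0_norm.
rewrite -zr; apply: le_trans (cmod_ge0 (w r%:C)) _.
by apply: (le_max_modulus (B := expR (cmod (r%:C : C) `^ 1 * K))) => z <-.
Qed.

Lemma max_modulus_lower : exists2 c, 0 < c &
  forall r N, 1 <= r -> (2 <= N)%N ->
  c * \prod_(2 <= k < N) (1 + 2 * r / b k) <= max_modulus w r ^+ 4.
Proof.
have [|K _ wK] := @w_upper 1 _ sum_powRN1; first by rewrite ltr01 lexx.
have [c c0 wc] := w_lower; exists c => // r N r1 N2.
have r0 : 0 <= r := le_trans ler01 r1.
apply: (le_trans (wc _ _ r1 N2)).
have zr : cmod (0 +i* r : C) = r.
  by rewrite /cmod /= expr0n add0r sqrtr_sqr ger0_norm.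
rewrite ler_pXn2r ?nnegrE ?cmod_ge0 ?max_modulus_ge0 // -{2}zr.
by apply: (le_max_modulus (B := expR (cmod (0 +i* r : C) `^ 1 * K))) => z <-.
Qed.

Lemma growth_order_le al : 0 < al <= 1 ->
  bounded_sums (fun n => b n `^ (- al)) -> (growth_order w <= al%:E)%E.
Proof.
move=> al01 /(ln_max_modulus_le al01) [K K0 wK].
apply/lee_addgt0Pr => e e0; rewrite -EFinD.
have K1 : 0 < K + 1 by rewrite ltr_wpDl.
have lnK1 : 0 <= ln (K + 1) by rewrite ln_ge0 // lerDr.
apply: (limf_esup_le_near (r0 := 1 + expR (ln (K + 1) / e))) => r rr.
have r1 : 1 < r by apply: lt_trans rr; rewrite ltrDl expR_gt0.
have r0 : 0 < r := lt_trans ltr01 r1.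
have lr : 0 < ln r by rewrite ln_gt0.
have r_al : 1 <= r `^ al by rewrite -(powRr0 r) ler_powR // ltW //; case/andP: al01.
have leK : ln (K + 1) <= e * ln r.
  rewrite mulrC -ler_pdivrMr // -[leLHS]expRK ler_ln ?posrE ?expR_gt0 //.
  by apply: ltW (lt_trans _ rr); rewrite ltrDr ltr01.
rewrite lee_fin ler_pdivrMr // mulrDl.
apply: (@le_trans _ _ (ln (r `^ al * (K + 1)))); last first.
  by rewrite lnM ?posrE ?powR_gt0 // ln_powR lerD2l.
have big1 : 1 <= r `^ al * (K + 1) by rewrite -[leLHS]mul1r ler_pM // lerDr.
apply: ln_le_of_le_expR; first exact: ln_ge0.
rewrite lnK ?posrE ?(lt_le_trans ltr01) //.
by rewrite (le_trans (wK _ (ltW r0))) // ler_wpM2l ?powR_ge0 // lerDl.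
Qed.

Lemma growth_order_ge0 : (0 <= growth_order w)%E.
Proof.
have [c c0 wc] := max_modulus_lower.
apply: (limf_esup_ge_near (r0 := 1 + b 2 * expR 4 / c)) => r rr.
have be0 : 0 < b 2 * expR 4 / c by rewrite divr_gt0 ?mulr_gt0 ?expR_gt0.
have r1 : 1 < r by apply: lt_trans rr; rewrite ltrDl.
have r0 : 0 < r := lt_trans ltr01 r1.
have lr : 0 < ln r by rewrite ln_gt0.
rewrite lee_fin divr_ge0 ?(ltW lr) //; apply: ln_ge0.
have M4 : expR 1 ^+ 4 <= max_modulus w r ^+ 4.
  apply: le_trans (wc r 3 (ltW r1) isT); rewrite big_nat1 -expRM_natl mulr1.
  rewrite mulrC -ler_pdivrMr //.
  have : b 2 * expR 4 / c < r by apply: lt_trans rr; rewrite ltrDr.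
  rewrite -mulrA mulrC -ltr_pdivlMr // => /ltW /le_trans; apply.
  rewrite -mulrA -[leLHS]mul1r -[leLHS]add0r lerD // ler_wpM2r ?ler1n //.
  by rewrite divr_ge0 ?ltW.
have M0 : expR 1 <= max_modulus w r.
  by rewrite -(@ler_pXn2r _ 4) // ?nnegrE ?expR_ge0 ?max_modulus_ge0 ?ltW.
rewrite -[leLHS](expRK (1 : R)) ler_ln ?posrE ?expR_gt0 //.
by apply: lt_le_trans M0; exact: expR_gt0.
Qed.

Lemma ln_prod_ge1 (f : nat -> R) m n : (forall k, 1 <= f k) ->
  1 <= \prod_(m <= k < n) f k /\
  ln (\prod_(m <= k < n) f k) = \sum_(m <= k < n) ln (f k).
Proof.
move=> f1; elim: n => [|n [IH1 IH2]]; first by rewrite !big_geq // ln1.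
have [mn|nm] := leqP m n; last by rewrite !big_geq // ln1.
rewrite !big_nat_recr //= -IH2 lnM ?posrE ?(lt_le_trans ltr01) //; split => //.
by rewrite -[leLHS]mul1r ler_pM.
Qed.

(** If the order is below [al], then [\sum_k b_k ^ (- al')] is finite for
    every [al' > al]. *)
Lemma summable_of_growth_order_lt al al' : 0 < al -> al < al' ->
  (growth_order w < al%:E)%E -> bounded_sums (fun n => b n `^ (- al')).
Proof.
move=> al0 alal' /limf_esup_lt_near [r0 wr0].
have [c c0 wc] := max_modulus_lower.
apply: (@summable_of_log_product _ b al al' (4 + `|ln c|) (1 + `|r0|) 2) => //.
move=> r N rr.
have r1 : 1 < r by apply: le_lt_trans rr; rewrite lerDl.
have rgt0 : 0 < r := lt_trans ltr01 r1.
have lr : 0 < ln r by rewrite ln_gt0.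
have r0r : r0 < r.
  by apply: le_lt_trans rr; rewrite (le_trans (ler_norm _)) // lerDr.
have lnM_le : ln (max_modulus w r) <= r `^ al.
  by apply: ln_le_powR lr => //; rewrite -lte_fin; exact: wr0.
have ra1 : 1 <= r `^ al by rewrite -(powRr0 r) ler_powR // ltW.
have [N2|N2] := ltnP N 2.
  by rewrite big_geq ?(ltnW N2) // mulr_ge0 ?powR_ge0 ?addr_ge0.
have f1 k : 1 <= 1 + 2 * r / b k.
  by rewrite lerDl divr_ge0 ?mulr_ge0 ?(ltW rgt0) ?(ltW (b_gt0 _)).
have [prod_ge1 ln_prod] := ln_prod_ge1 2 N f1.
have h := wc r N (ltW r1) N2.
have M0 : 0 < max_modulus w r.
  rewrite lt_neqAle max_modulus_ge0 ?(ltW rgt0) // andbT eq_sym.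
  apply: contraTneq h => ->; rewrite expr0n /= -ltNge mulr_gt0 //.
  exact: lt_le_trans prod_ge1.
have prod_gt0 := lt_le_trans ltr01 prod_ge1.
move: h; rewrite -ler_ln ?posrE ?(mulr_gt0 c0 prod_gt0) ?exprn_gt0 //.
rewrite lnM ?posrE // lnXn // -(mulr_natl (ln (max_modulus w r)) 4) ln_prod => h.
have lc : - `|ln c| <= ln c by rewrite lerNl -normrN ler_norm.
have lcr : `|ln c| <= `|ln c| * r `^ al by rewrite ler_peMr.
rewrite [leRHS]mulrDl; move: h lcr lc lnM_le.
set A := r `^ al; set T := \sum_(2 <= k < N) _; set B := ln (max_modulus w r).
by set D := ln c; lra.
Qed.

Lemma growth_orderE : growth_order w = convergence_exponent b.
Proof.
have conv_le al : 0 < al -> bounded_sums (fun n => b n `^ (- al)) ->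
    (convergence_exponent b <= al%:E)%E.
  move=> al0 sal; apply: ereal_inf_lbound; exists al => //; split => //.
  under eq_eseriesr do rewrite ger0_norm ?(ltW (b_gt0 _)) //.
  by apply: nneseries_of_bounded_sums => // n; exact: powR_ge0.
have conv_le1 : (convergence_exponent b <= 1)%E by exact: conv_le sum_powRN1.
apply/eqP; rewrite eq_le; apply/andP; split.
  apply/ereal_infP => _ [al [al0 sal] <-].
  have {}sal : bounded_sums (fun n => b n `^ (- al)).
    apply: (bounded_sums_of_nneseries (m := 0)) => [n|]; first exact: powR_ge0.
    by under eq_eseriesr do rewrite -[b _](@ger0_norm _ (b _)) ?(ltW (b_gt0 _)) //.
  have [al1|/ltW al1] := leP al 1; first by apply: growth_order_le => //; rewrite al0.
  apply: (@le_trans _ _ 1%:E); last by rewrite lee_fin.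
  by apply: growth_order_le sum_powRN1; rewrite ltr01 lexx.
rewrite leNgt; apply/negP => lt_gc.
have g0 := growth_order_ge0.
have g_fin : growth_order w \is a fin_num.
  by rewrite ge0_fin_numE // (lt_trans lt_gc) // (le_lt_trans conv_le1) // ltry.
have c_fin : convergence_exponent b \is a fin_num.
  by rewrite ge0_fin_numE ?(le_lt_trans conv_le1) ?ltry // (le_trans g0) // ltW.
move: lt_gc g0; set t := convergence_exponent b in c_fin *; rewrite -(fineK g_fin) -(fineK c_fin).
set s := fine (growth_order w); set u := fine t; rewrite lte_fin lee_fin => su s0.
have al_gt0 : 0 < (2 * s + u) / 3 by rewrite divr_gt0 //; lra.
have lt1 : (2 * s + u) / 3 < (s + 2 * u) / 3 by rewrite ltr_pM2r ?invr_gt0 //; lra.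
have lt2 : s < (2 * s + u) / 3 by rewrite ltr_pdivlMr //; lra.
have lt3 : (s + 2 * u) / 3 < u by rewrite ltr_pdivrMr //; lra.
have /conv_le : bounded_sums (fun n => b n `^ (- ((s + 2 * u) / 3))).
  apply: (summable_of_growth_order_lt al_gt0 lt1).
  by rewrite -(fineK g_fin) lte_fin.
rewrite -/t -(fineK c_fin) -/u lee_fin leNgt lt3 => /(_ (lt_trans al_gt0 lt1)).
by [].
Qed.

Lemma growth_type_lty rho : growth_order w = rho%:E ->
  bounded_sums (fun n => b n `^ (- rho)) -> (growth_type rho w < +oo)%E.
Proof.
move=> ord sb; have rho0 : 0 <= rho by rewrite -lee_fin -ord growth_order_ge0.
have rho1 : rho <= 1.
  rewrite -lee_fin -ord; apply: growth_order_le sum_powRN1.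
  by rewrite ltr01 lexx.
(* rho = 0 is excluded, since then the terms b_n ^ (- rho) would all be 1 *)
have rho_gt0 : 0 < rho.
  rewrite lt_neqAle rho0 andbT; apply/eqP => rho_eq0.
  have [M bM] := sb; have := bM (Num.bound M).
  rewrite (eq_bigr (fun=> 1)) => [|k _]; last by rewrite -rho_eq0 oppr0 powRr0.
  rewrite sumr_const_nat subn0 leNgt => /negP; apply.
  have M0 : 0 <= M by have := bM 0%N; rewrite big_geq.
  by have := archi_boundP M0.
have [|K K0 wK] := ln_max_modulus_le _ sb; first by rewrite rho_gt0.
apply: (@le_lt_trans _ _ K%:E); last exact: ltry.
apply: (limf_esup_le_near (r0 := 0)) => r r0; rewrite lee_fin.
by rewrite powRN mulrC ler_pdivrMr ?powR_gt0 // mulrC wK // ltW.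
Qed.

End OrderFromBounds.

(** * The minimal operator and the limit circle case *)

Section SquareSummable.
Context {R : realType}.
Local Notation C := R[i].
Implicit Types (u v x y : nat -> C).

Lemma l2P u : l2 u <-> bounded_sums (fun n => cmod (u n) ^+ 2).
Proof.
split=> [|bu]; first by apply: bounded_sums_of_nneseries => n; exact: sqr_ge0.
by apply: nneseries_of_bounded_sums => // n; exact: sqr_ge0.
Qed.

Lemma l2_sqnorm_lt_sum u (e : R) : (l2_sqnorm u < e%:E)%E ->
  forall n, \sum_(0 <= k < n) cmod (u k) ^+ 2 <= e.
Proof.
move=> ue n; rewrite -lee_fin -sumEFin; apply: le_trans (ltW ue).
by apply: nneseries_lim_ge => k _ _; rewrite lee_fin sqr_ge0.
Qed.

Lemma l2_sqnorm_le u (e : R) :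
  (forall n, \sum_(0 <= k < n) cmod (u k) ^+ 2 <= e) -> (l2_sqnorm u <= e%:E)%E.
Proof.
move=> ue; apply: lime_le.
  by apply: is_cvg_nneseries => n _ _; rewrite lee_fin sqr_ge0.
by apply: nearW => n; rewrite sumEFin lee_fin.
Qed.

Lemma sqr_cmodB_le (z w : C) : cmod (z - w) ^+ 2 <= 2 * cmod z ^+ 2 + 2 * cmod w ^+ 2.
Proof.
have h : cmod (z - w) ^+ 2 <= (cmod z + cmod w) ^+ 2.
  by rewrite ler_pXn2r ?nnegrE ?addr_ge0 ?cmod_ge0 // le_cmodB.
apply: (le_trans h); rewrite -subr_ge0.
have -> : 2 * cmod z ^+ 2 + 2 * cmod w ^+ 2 - (cmod z + cmod w) ^+ 2
  = (cmod z - cmod w) ^+ 2 by ring.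
exact: sqr_ge0.
Qed.

Lemma l2B u v : l2 u -> l2 v -> l2 (u - v).
Proof.
move=> /l2P lu /l2P lv; apply/l2P.
have two0 : 0 <= 2 :> R by [].
apply: (@bounded_sums_le _ _ (fun n => 2 * cmod (u n) ^+ 2 + 2 * cmod (v n) ^+ 2) 1 0).
- by move=> n; exact: sqr_ge0.
- exact: ler01.
- by move=> n _; rewrite mul1r; exact: sqr_cmodB_le.
- by move=> n; apply: addr_ge0; apply: mulr_ge0 => //; exact: sqr_ge0.
- by apply: bounded_sumsD; apply: bounded_sumsZ.
Qed.

Lemma l2Z (c : C) u : l2 u -> l2 (c *: u).
Proof.
move=> /l2P lu; apply/l2P; have := bounded_sumsZ (sqr_ge0 (cmod c)) lu.
move=> [M cM]; exists M => n; apply: le_trans (cM n).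
apply: ler_sum => k _; rewrite -exprMn -cmodM; exact: lexx.
Qed.

Lemma l2_finite u : finitely_supported u -> l2 u.
Proof.
move=> [N uN]; apply/l2P; apply: (bounded_sums_tail (N := N) (M := 0)) => n.
  exact: sqr_ge0.
by rewrite big_nat big1 // => i /andP[/uN -> _]; rewrite cmod0 expr0n.
Qed.

Lemma mul_conjc_le (t : R) (z w : C) : 0 < t ->
  cmod (z * conjc w) <= (t * cmod z ^+ 2 + t^-1 * cmod w ^+ 2) / 2.
Proof.
move=> t0; rewrite cmodM cmod_conjc.
set x := cmod z; set y := cmod w.
have -> : (t * x ^+ 2 + t^-1 * y ^+ 2) / 2 = x * y + t^-1 / 2 * (t * x - y) ^+ 2.
  by field; rewrite gt_eqF.
by rewrite lerDl mulr_ge0 ?sqr_ge0 // divr_ge0 // invr_ge0 ltW.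
Qed.

Lemma l2_inner_csum u v : l2 u -> l2 v ->
  csum_to (fun n => u n * conjc (v n)) (l2_inner u v).
Proof.
move=> /l2P lu /l2P lv.
have [l ul] : exists l, csum_to (fun n => u n * conjc (v n)) l.
  apply: csum_to_ex.
  apply: (@bounded_sums_le _ _ (fun n => cmod (u n) ^+ 2 + cmod (v n) ^+ 2) 2^-1 0).
  - by move=> n; exact: cmod_ge0.
  - by rewrite invr_ge0.
  - move=> n _; have := mul_conjc_le (u n) (v n) (@ltr01 R).
    by rewrite invr1 !mul1r => h; rewrite [leRHS]mulrC.
  - by move=> n; apply: addr_ge0; exact: sqr_ge0.
  - exact: bounded_sumsD.
by rewrite /l2_inner (num_sum_csum_to ul).
Qed.

Lemma l2_innerBl u v x : l2 u -> l2 v -> l2 x ->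
  l2_inner (u - v) x = l2_inner u x - l2_inner v x.
Proof.
move=> lu lv lx; apply: csum_to_uniq (l2_inner_csum (l2B lu lv) lx) _.
have := csum_toB (l2_inner_csum lu lx) (l2_inner_csum lv lx).
by under eq_fun do rewrite -mulrBl.
Qed.

Lemma l2_innerBr u x y : l2 u -> l2 x -> l2 y ->
  l2_inner u (x - y) = l2_inner u x - l2_inner u y.
Proof.
move=> lu lx ly; apply: csum_to_uniq (l2_inner_csum lu (l2B lx ly)) _.
have := csum_toB (l2_inner_csum lu lx) (l2_inner_csum lu ly).
by under eq_fun do rewrite -mulrBr -rmorphB.
Qed.

Lemma cmod_inner_le (t A B : R) u v : 0 < t -> l2 u -> l2 v ->
  (forall n, \sum_(0 <= k < n) cmod (u k) ^+ 2 <= A) ->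
  (forall n, \sum_(0 <= k < n) cmod (v k) ^+ 2 <= B) ->
  cmod (l2_inner u v) <= (t * A + t^-1 * B) / 2.
Proof.
move=> t0 lu lv uA vB; apply: (csum_to_le (l2_inner_csum lu lv)) => n.
apply: (le_trans (le_cmod_sum _ _)).
apply: (@le_trans _ _ (\sum_(0 <= k < n)
    (t * cmod (u k) ^+ 2 + t^-1 * cmod (v k) ^+ 2) / 2)).
  by apply: ler_sum => k _; exact: mul_conjc_le.
rewrite -mulr_suml ler_wpM2r ?invr_ge0 // big_split /= -!mulr_sumr.
by rewrite lerD // ler_wpM2l ?invr_ge0 ?(ltW t0).
Qed.

(** Continuity of the inner product, in the weighted form that needs no square
    roots. *)
Lemma cmod_inner_small (d B : R) u v : 0 < d -> l2 u -> l2 v ->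
  (forall n, \sum_(0 <= k < n) cmod (u k) ^+ 2 <= d ^+ 2) ->
  (forall n, \sum_(0 <= k < n) cmod (v k) ^+ 2 <= B) ->
  cmod (l2_inner u v) <= d * (1 + B) / 2 /\ cmod (l2_inner v u) <= d * (1 + B) / 2.
Proof.
move=> d0 lu lv ud vB; split.
  have d1 : 0 < d^-1 by rewrite invr_gt0.
  apply: (le_trans (cmod_inner_le d1 lu lv ud vB)).
  by rewrite invrK le_eqVlt; apply/orP; left; apply/eqP; field; rewrite gt_eqF.
apply: (le_trans (cmod_inner_le d0 lv lu vB ud)).
by rewrite le_eqVlt; apply/orP; left; apply/eqP; field; rewrite gt_eqF.
Qed.

Lemma bounded_sums_tail_small (e : nat -> R) (d : R) : (forall n, 0 <= e n) ->
  bounded_sums e -> 0 < d ->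
  exists N, forall n, \sum_(N <= k < n) e k <= d.
Proof.
move=> e0 [M eM] d0.
have hs : has_sup (range (fun n => \sum_(0 <= k < n) e k)).
  by split; [exists (\sum_(0 <= k < 0) e k), 0%N | exists M => _ [n _ <-]].
have [_ [N _ <-] hN] := sup_adherent d0 hs; exists N => n.
have [nN|Nn] := leqP n N; first by rewrite big_geq ?(ltW d0).
have : \sum_(0 <= k < n) e k <= sup (range (fun n => \sum_(0 <= k < n) e k)).
  by apply: ub_le_sup; [case: hs|exists n].
move: hN; rewrite (big_cat_nat _ (n := N) (p := n)) ?(ltnW Nn) //=; lra.
Qed.

End SquareSummable.

Section LimitCircle.
Context {R : realType}.
Local Notation C := R[i].
Local Open Scope complex_scope.
Variables a b : nat -> R.
Hypothesis b_gt0 : forall n, 0 < b n.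
Local Notation J := (jacobi_apply a b).
Implicit Types (f g x y : nat -> C).

Lemma jacobi_apply_finite f : finitely_supported f -> finitely_supported (J f).
Proof.
move=> [N fN]; exists N.+1 => -[//|n] Nn /=.
rewrite !fN ?mulr0 ?addr0 //; first by rewrite ltnW // ltnW.
exact: ltnW.
Qed.

Lemma jacobi_apply0 x : J x 0%N = (a 0%N)%:C * x 0%N + (b 0%N)%:C * x 1%N.
Proof. by []. Qed.

Lemma jacobi_applyS x n : J x n.+1 =
  (b n)%:C * x n + (a n.+1)%:C * x n.+1 + (b n.+1)%:C * x n.+2.
Proof. by []. Qed.

Let conjcD (z w : C) : conjc (z + w) = conjc z + conjc w.
Proof. exact: rmorphD. Qed.

Let conjcMr (r : R) (z : C) : conjc (r%:C * z) = r%:C * conjc z.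
Proof. by rewrite [LHS]rmorphM -[in RHS](conjc_real r). Qed.

(** Green's formula. *)
Lemma green_formula f x n :
  \sum_(0 <= k < n.+1) (J f k * conjc (x k) - f k * conjc (J x k)) =
  (b n)%:C * (f n.+1 * conjc (x n) - f n * conjc (x n.+1)).
Proof.
elim: n => [|n IHn].
  rewrite big_nat1 !jacobi_apply0 !conjcD !conjcMr; ring.
rewrite big_nat_recr // IHn !jacobi_applyS !conjcD !conjcMr; rewrite -[LHS]/(_ + _); ring.
Qed.

Lemma inner_jacobi_finite f x : finitely_supported f ->
  l2_inner (J f) x = l2_inner f (J x).
Proof.
move=> ff; have [N fN] := ff; have [N' JfN] := jacobi_apply_finite ff.
pose m := (maxn N N').+1.
have Nm n : (m <= n)%N -> (N <= n)%N /\ (N' <= n)%N.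
  by move=> /ltnW; rewrite geq_max => /andP.
have h1 : csum_to (fun n => J f n * conjc (x n)) (\sum_(0 <= k < m) J f k * conjc (x k)).
  by apply: csum_to_finite => n /Nm [_ /JfN ->]; rewrite mul0r.
have h2 : csum_to (fun n => f n * conjc (J x n)) (\sum_(0 <= k < m) f k * conjc (J x k)).
  by apply: csum_to_finite => n /Nm [/fN -> _]; rewrite mul0r.
rewrite /l2_inner (num_sum_csum_to h1) (num_sum_csum_to h2).
apply/eqP; rewrite -subr_eq0 -sumrB green_formula.
by rewrite !fN ?leq_maxl ?(leqW (leq_maxl _ _)) // !mul0r subrr mulr0.
Qed.

Lemma jacobi_min_finite f : finitely_supported f -> jacobi_min a b (f, J f).
Proof.
move=> ff; split; rewrite /=; [exact: l2_finite| |].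
  exact/l2_finite/jacobi_apply_finite.
move=> e e0; exists (f, J f); first by exists f.
rewrite /= !subrr; suff h : (l2_sqnorm (0%R : nat -> C) < e%:E)%E by [].
apply: (@le_lt_trans _ _ 0%:E); last by rewrite lte_fin.
apply: l2_sqnorm_le => n; rewrite big1 // => k _.
by rewrite [X in cmod X](_ : _ = 0) // cmod0 expr0n.
Qed.

(** Membership in the adjoint only has to be tested on finitely supported
    sequences. *)
Lemma adjoint_jacobi_min x y : l2 x -> l2 y ->
  (forall f, finitely_supported f -> l2_inner (J f) x = l2_inner f y) ->
  graph_adjoint (jacobi_min a b) (x, y).
Proof.
move=> lx ly fxy; split => //= -[u v] [/= lu lv uv].
have [/l2P [A xA] /l2P [B yB]] := (lx, ly).
apply/eqP; rewrite -subr_eq0; apply/eqP/eq0_cmod => e e0.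
have A0 : 0 <= A by have := xA 0%N; rewrite big_geq.
have B0 : 0 <= B by have := yB 0%N; rewrite big_geq.
have AB : 0 < 2 + A + B by rewrite -addrA ltr_wpDr ?addr_ge0.
pose d := e / (2 + A + B); have d0 : 0 < d by rewrite divr_gt0.
have [_ [f ff <-] /= [uf vJf]] := uv (d ^+ 2) (exprn_gt0 2 d0).
have lf := l2_finite ff; have lJf := l2_finite (jacobi_apply_finite ff).
have -> : l2_inner v x - l2_inner u y = l2_inner (v - J f) x - l2_inner (u - f) y.
  rewrite !l2_innerBl // (fxy _ ff); ring.
have [h1 _] := cmod_inner_small d0 (l2B lv lJf) lx (l2_sqnorm_lt_sum vJf) xA.
have [h2 _] := cmod_inner_small d0 (l2B lu lf) ly (l2_sqnorm_lt_sum uf) yB.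
apply: le_trans (le_cmodB _ _) _; apply: le_trans (lerD h1 h2) _.
have -> : d * (1 + A) / 2 + d * (1 + B) / 2 = e / 2 by rewrite /d; field; rewrite gt_eqF.
by rewrite ler_pdivrMr // ler_peMr ?(ltW e0) // ler1n.
Qed.

Lemma jacobi_min_symmetric : symmetric_operator (jacobi_min a b).
Proof.
split.
  move=> x lx e e0; have /l2P bx := lx.
  have e20 : 0 < e / 2 by rewrite divr_gt0.
  have [N hN] := bounded_sums_tail_small (fun n => sqr_ge0 (cmod (x n))) bx e20.
  pose d n := if (n < N)%N then x n else 0.
  have fd : finitely_supported d.
    by exists N => n Nn; rewrite /d ltnNge Nn.
  exists d; first by exists (J d); exact: jacobi_min_finite.
  apply: (@le_lt_trans _ _ (e / 2)%:E); last by rewrite lte_fin gtr_pMr // invf_lt1 // ltr1n.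
  apply: l2_sqnorm_le => n.
  have xd k : cmod ((x - d) k) ^+ 2 = if (k < N)%N then 0 else cmod (x k) ^+ 2.
    have [kN|Nk] := ltnP k N.
      rewrite (_ : (x - d) k = 0) ?cmod0 ?expr0n //.
      by rewrite [LHS]/(x k - d k) /d kN; exact: subrr.
    by rewrite (_ : (x - d) k = x k) // [LHS]/(x k - d k) /d ltnNge Nk; exact: subr0.
  under eq_bigr do rewrite xd.
  apply: (@le_trans _ _ (\sum_(0 <= k < maxn n N) if (k < N)%N then 0 else cmod (x k) ^+ 2)).
    rewrite [leRHS](big_cat_nat _ (n := n)) ?leq_maxl //= lerDl sumr_ge0 // => k _.
    by case: ifP => // _; exact: sqr_ge0.
  rewrite (big_cat_nat _ (n := N)) ?leq_maxr //= [X in X + _]big_nat big1; last first.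
    by move=> k /andP[_ ->].
  rewrite add0r; apply: le_trans (hN (maxn n N)).
  by apply: ler_sum_nat => k /andP[Nk _]; rewrite ltnNge Nk.
move=> [x y] [/= lx ly xy]; apply: adjoint_jacobi_min => // f ff.
have lf := l2_finite ff; have lJf := l2_finite (jacobi_apply_finite ff).
have [/l2P [A fA] /l2P [B JfB]] := (lf, lJf).
apply/eqP; rewrite -subr_eq0; apply/eqP/eq0_cmod => e e0.
have A0 : 0 <= A by have := fA 0%N; rewrite big_geq.
have B0 : 0 <= B by have := JfB 0%N; rewrite big_geq.
have AB : 0 < 2 + A + B by rewrite -addrA ltr_wpDr ?addr_ge0.
pose d := e / (2 + A + B); have d0 : 0 < d by rewrite divr_gt0.
have [_ [g fg <-] /= [xg yJg]] := xy (d ^+ 2) (exprn_gt0 2 d0).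
have lg := l2_finite fg; have lJg := l2_finite (jacobi_apply_finite fg).
have -> : l2_inner (J f) x - l2_inner f y =
    l2_inner (J f) (x - g) - l2_inner f (y - J g).
  rewrite !l2_innerBr // (inner_jacobi_finite g ff); ring.
have [_ h1] := cmod_inner_small d0 (l2B lx lg) lJf (l2_sqnorm_lt_sum xg) JfB.
have [_ h2] := cmod_inner_small d0 (l2B ly lJg) lf (l2_sqnorm_lt_sum yJg) fA.
apply: le_trans (le_cmodB _ _) _; apply: le_trans (lerD h1 h2) _.
have -> : d * (1 + B) / 2 + d * (1 + A) / 2 = e / 2 by rewrite /d; field; rewrite gt_eqF.
by rewrite ler_pdivrMr // ler_peMr ?(ltW e0) // ler1n.
Qed.

Lemma jacobi_apply_orthopoly1 z n :
  J (fun k => orthopoly1 a b k z) n = z * orthopoly1 a b n z.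
Proof.
have bn k : (b k)%:C != 0 by rewrite fmorph_eq0 gt_eqF.
case: n => [|n].
  rewrite jacobi_apply0.
  have -> : orthopoly1 a b 1 z = (z - (a 0%N)%:C) / (b 0%N)%:C by [].
  have -> : orthopoly1 a b 0 z = 1 by [].
  by field; exact: bn.
rewrite jacobi_applyS.
have -> : orthopoly1 a b n.+2 z = ((z - (a n.+1)%:C) * orthopoly1 a b n.+1 z
  - (b n)%:C * orthopoly1 a b n z) / (b n.+1)%:C by [].
move: (orthopoly1 a b n z) (orthopoly1 a b n.+1 z) => p0 p1.
by field; exact: bn.
Qed.

Lemma jacobi_eigen_unique x z : (forall n, J x n = z * x n) ->
  forall n, x n = x 0 * orthopoly1 a b n z.
Proof.
move=> Jx n; have bn k : (b k)%:C != 0 by rewrite fmorph_eq0 gt_eqF.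
have Jp := jacobi_apply_orthopoly1 z.
pose p k := orthopoly1 a b k z.
suff : x n = x 0 * p n /\ x n.+1 = x 0 * p n.+1 by case.
elim: n => [|n [IH IH']]; split => //.
- by rewrite /p /orthopoly1 /= mulr1.
- apply: (mulfI (bn 0)); have := Jx 0; have := Jp 0; rewrite !jacobi_apply0 -/(p 0) -/(p 1%N).
  have -> : p 0 = 1 by [].
  move=> hp hx.
  have -> : (b 0)%:C * x 1%N = z * x 0 - (a 0)%:C * x 0 by rewrite -hx; ring.
  have -> : (b 0)%:C * (x 0 * p 1%N) = x 0 * ((a 0)%:C * 1 + (b 0)%:C * p 1%N)
    - x 0 * (a 0)%:C by ring.
  by rewrite hp; ring.
- apply: (mulfI (bn n.+1)); have := Jx n.+1; have := Jp n.+1.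
  rewrite !jacobi_applyS -/(p n) -/(p n.+1) -/(p n.+2) IH IH'.
  move: (p n) (p n.+1) (p n.+2) (x n.+2) => u0 u1 u2 x2 hp hx.
  have -> : (b n.+1)%:C * x2 = z * (x 0 * u1) - (b n)%:C * (x 0 * u0)
    - (a n.+1)%:C * (x 0 * u1) by rewrite -hx; ring.
  have -> : (b n.+1)%:C * (x 0 * u2) = x 0 * (z * u1) - (b n)%:C * (x 0 * u0)
    - (a n.+1)%:C * (x 0 * u1) by rewrite -hp; ring.
  ring.
Qed.

(** The kernel of [T^* - z] is spanned by the polynomials of the first kind. *)
Lemma deficiency_dim z : l2 (fun n => orthopoly1 a b n z) ->
  has_dim (deficiency_space (jacobi_min a b) z) 1.
Proof.
move=> lp; exists (fun _ n => orthopoly1 a b n z); split.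
  move=> c; rewrite big_ord1 => /(congr1 (fun u => u 0%N)) c0 i.
  rewrite (ord1 i) -[LHS]mulr1; exact: c0.
apply/seteqP; split => [x [/= lx lzx xadj]|_ [c _ <-]].
  exists (fun _ => x 0%N) => //; rewrite big_ord1; apply/funext => n.
  apply/esym; apply: jacobi_eigen_unique => {}n.
  (* tested against the n-th unit vector *)
  pose f k : C := if k == n then 1 else 0.
  have ff : finitely_supported f.
    by exists n.+1 => k nk; rewrite /f gtn_eqF.
  have fv (v : nat -> C) : l2_inner f v = conjc (v n).
    suff h : csum_to (fun k => f k * conjc (v k)) (conjc (v n)).
      exact: num_sum_csum_to h.
    have -> : conjc (v n) = \sum_(0 <= k < n.+1) f k * conjc (v k).
      rewrite big_nat_recr //= big_nat big1 ?add0r; last first.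
        by move=> k /andP[_ kn]; rewrite /f ltn_eqF // mul0r.
      by rewrite /f eqxx mul1r.
    by apply: csum_to_finite => k nk; rewrite /f gtn_eqF // mul0r.
  have := xadj _ (jacobi_min_finite ff); rewrite /= inner_jacobi_finite // !fv.
  exact: (can_inj (@conjcK R)).
rewrite big_ord1; set p := fun n => orthopoly1 a b n z.
have lcp : l2 (c ord0 *: p) := l2Z _ lp.
apply: adjoint_jacobi_min => [//||f ff]; first exact: l2Z.
rewrite inner_jacobi_finite //; congr l2_inner; apply/funext => n.
have Jp := jacobi_apply_orthopoly1 z n.
have -> : J (c ord0 *: p) n = c ord0 * J p n.
  have cpk k : (c ord0 *: p) k = c ord0 * p k by [].
  by case: n {Jp} => [|n]; rewrite ?jacobi_apply0 ?jacobi_applyS !cpk; ring.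
by rewrite Jp mulrCA.
Qed.

Lemma limit_circle_of_l2 :
  l2 (fun n => orthopoly1 a b n (0 +i* 1)) ->
  l2 (fun n => orthopoly1 a b n (0 -i* 1)) -> limit_circle a b.
Proof.
move=> lp lm; split; first exact: jacobi_min_symmetric.
by split; exact: deficiency_dim.
Qed.

End LimitCircle.

(** * The entries of the Nevanlinna matrix *)

Section Entries.
Context {R : realType}.
Local Notation C := R[i].
Local Open Scope complex_scope.
Variables (a b : nat -> R) (K : R).
Hypothesis b_gt0 : forall n, 0 < b n.
Hypothesis sum_invb : bounded_sums (fun n => (b n)^-1).
Hypothesis weight_le : forall n, b n * transfer_weight a b n <= K.

Lemma orthopoly1_csol n z : orthopoly1 a b n z = csol a b z (-1) 0 n.
Proof.
have bC : (b 0%N)%:C != 0 :> C by rewrite fmorph_eq0 gt_eqF.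
have c0 : csol a b z (-1) 0 0 = 1.
  change (- (-1)%:C * 1%:C + 0%:C * 0%:C = 1 :> C).
  by rewrite rmorphN rmorph1 rmorph0; ring.
have p01 : (p0 a b 1)%:C = - (a 0%N)%:C / (b 0%N)%:C.
  by rewrite -rmorphN -fmorph_div.
have q01 : (q0 a b 1)%:C = ((b 0%N)%:C)^-1 by rewrite -fmorphV.
have c1 : csol a b z (-1) 0 1 = (z - (a 0%N)%:C) / (b 0%N)%:C.
  rewrite /csol coeffXS coeffYS c0 p01 q01.
  change (- ((-1)%:C + z * 0%:C * 1) * (- (a 0%N)%:C / (b 0%N)%:C)
    + (0%:C + z * 1%:C * 1) / (b 0%N)%:C = (z - (a 0%N)%:C) / (b 0%N)%:C).
  by rewrite rmorphN rmorph1 rmorph0; field.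
by rewrite -jacobi_sol_csol // c0 c1.
Qed.

Lemma orthopoly2_csol n z : orthopoly2 a b n z = csol a b z 0 1 n.
Proof.
have bC : (b 0%N)%:C != 0 :> C by rewrite fmorph_eq0 gt_eqF.
have c0 : csol a b z 0 1 0 = 0.
  change (- 0%:C * 1%:C + 1%:C * 0%:C = 0 :> C).
  by rewrite rmorph1 rmorph0; ring.
have q01 : (q0 a b 1)%:C = ((b 0%N)%:C)^-1 by rewrite -fmorphV.
have c1 : csol a b z 0 1 1 = 1 / (b 0%N)%:C.
  rewrite /csol coeffXS coeffYS c0 q01.
  change (- (0%:C + z * 0%:C * 0) * (p0 a b 1)%:C
    + (1%:C + z * 1%:C * 0) / (b 0%N)%:C = 1 / (b 0%N)%:C).
  by rewrite rmorph1 rmorph0; ring.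
by rewrite -jacobi_sol_csol // c0 c1.
Qed.

Lemma nevanlinnaA_limX : nevanlinnaA a b = fun z => limX a b z 0 1.
Proof.
apply/funext => z; rewrite /nevanlinnaA /limX rmorph0 add0r.
by congr (z * num_sum _); apply/funext => n; rewrite orthopoly2_0 // orthopoly2_csol.
Qed.

Lemma nevanlinnaB_limX : nevanlinnaB a b = fun z => limX a b z (-1) 0.
Proof.
apply/funext => z; rewrite /nevanlinnaB /limX rmorphN rmorph1.
by congr (-1 + z * num_sum _); apply/funext => n; rewrite orthopoly2_0 // orthopoly1_csol.
Qed.

Lemma nevanlinnaC_limY : nevanlinnaC a b = fun z => limY a b z 0 1.
Proof.
apply/funext => z; rewrite /nevanlinnaC /limY rmorph1.
by congr (1 + z * num_sum _); apply/funext => n; rewrite orthopoly1_0 // orthopoly2_csol.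
Qed.

Lemma nevanlinnaD_limY : nevanlinnaD a b = fun z => limY a b z (-1) 0.
Proof.
apply/funext => z; rewrite /nevanlinnaD /limY rmorph0 add0r.
by congr (z * num_sum _); apply/funext => n; rewrite orthopoly1_0 // orthopoly1_csol.
Qed.

Lemma nevanlinna_entry (i j : 'I_2) :
  [\/ (fun z => nevanlinna a b z i j) = nevanlinnaA a b,
      (fun z => nevanlinna a b z i j) = nevanlinnaB a b,
      (fun z => nevanlinna a b z i j) = nevanlinnaC a b |
      (fun z => nevanlinna a b z i j) = nevanlinnaD a b].
Proof.
rewrite /nevanlinna; case: (@split_ordP 1 1 i) => k ->;
  case: (@split_ordP 1 1 j) => l ->; rewrite (ord1 k) (ord1 l).
- by apply: Or41; apply/funext => z; rewrite [LHS](block_mxEul) mxE eqxx mulr1n.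
- by apply: Or43; apply/funext => z; rewrite [LHS](block_mxEur) mxE eqxx mulr1n.
- by apply: Or42; apply/funext => z; rewrite [LHS](block_mxEdl) mxE eqxx mulr1n.
- by apply: Or44; apply/funext => z; rewrite [LHS](block_mxEdr) mxE eqxx mulr1n.
Qed.

(** The property to be shown of each entry of the Nevanlinna matrix. *)
Definition regular_growth (w : C -> C) : Prop :=
  growth_order w = convergence_exponent b /\
  forall rho, growth_order w = rho%:E -> bounded_sums (fun n => b n `^ (- rho)) ->
    (growth_type rho w < +oo)%E.

Lemma lim_regular_growth (x0 y0 s0 : R) : `|x0| + `|y0| = 1 -> 0 < s0 ->
  (forall z, s0 <= sqsum a b z x0 y0 2) ->
  regular_growth (fun z => limX a b z x0 y0) /\
  regular_growth (fun z => limY a b z x0 y0).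
Proof.
move=> xy1 s0_gt0 s0_le.
have x0_le : `|x0| <= 1 by rewrite -xy1 lerDl.
have y0_le : `|y0| <= 1 by rewrite -xy1 lerDr.
have [W hW] := sum_transfer_weight b_gt0 sum_invb weight_le.
have W0 : 0 <= W by have := hW 0%N; rewrite big_geq.
pose L := (Num.sqrt s0)^-1 + (W + 1) / 2.
have L0 : 0 < L by rewrite /L addr_gt0 ?divr_gt0 ?invr_gt0 ?sqrtr_gt0 // ltr_wpDl.
have c0 : 0 < s0 ^+ 2 / L ^+ 4 by rewrite divr_gt0 ?exprn_gt0.
have low y N y1 N2 := @lim_coeffs_lower_bound _ a b K b_gt0 sum_invb weight_le y x0 y0 s0 y1
  x0_le y0_le s0_gt0 (s0_le _) W hW N N2.
have up al : 0 < al <= 1 -> bounded_sums (fun n => b n `^ (- al)) ->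
    exists2 B, 0 <= B & forall z n, coeff_size a b z x0 y0 n <= expR (cmod z `^ al * B).
  move=> al01 [S bS]; have /andP[al0 _] := al01.
  exists (K `^ al / al * S) => [|z n].
    rewrite mulr_ge0 ?divr_ge0 ?powR_ge0 ?(ltW al0) //.
    by have := bS 0%N; rewrite big_geq.
  by have := coeff_size_le b_gt0 weight_le al01 bS z x0 y0 n; rewrite xy1 mul1r.
have reg (w : C -> C) :
    (forall z M, (forall n, coeff_size a b z x0 y0 n <= M) -> cmod (w z) <= M) ->
    (forall y N, 1 <= y -> (2 <= N)%N ->
      s0 ^+ 2 / L ^+ 4 * \prod_(2 <= k < N) (1 + 2 * y / b k) <= cmod (w (0 +i* y)) ^+ 4) ->
    regular_growth w.
  move=> wM wlow.
  have w_up al : 0 < al <= 1 -> bounded_sums (fun n => b n `^ (- al)) ->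
      exists2 B, 0 <= B & forall z, cmod (w z) <= expR (cmod z `^ al * B).
    by move=> al01 /(up _ al01) [B B0 hB]; exists B => // z; exact: wM.
  have w_low : exists2 c, 0 < c & forall y N, 1 <= y -> (2 <= N)%N ->
      c * \prod_(2 <= k < N) (1 + 2 * y / b k) <= cmod (w (0 +i* y)) ^+ 4.
    by exists (s0 ^+ 2 / L ^+ 4).
  split; first exact: growth_orderE.
  by move=> rho; exact: growth_type_lty.
split; apply: reg => [z M|y N y1 N2].
- exact: limX_le.
- exact: (low y N y1 N2).1.
- exact: limY_le.
- exact: (low y N y1 N2).2.
Qed.

Lemma nevanlinna_regular_growth i j :
  regular_growth (fun z => nevanlinna a b z i j).
Proof.
have b0 := b_gt0 0%N.
have first_kind z : 1 <= sqsum a b z (-1) 0 2.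
  rewrite /sqsum big_nat_recl // big_nat1 -orthopoly1_csol.
  rewrite [orthopoly1 _ _ 0 _]/(1 : C) [cmod 1]ComplexField.Normc.normc1 expr1n.
  by rewrite lerDl sqr_ge0.
have second_kind z : (b 0%N)^-1 ^+ 2 <= sqsum a b z 0 1 2.
  rewrite /sqsum big_nat_recl // big_nat1 -!orthopoly2_csol.
  have -> : orthopoly2 a b 1 z = ((b 0%N)%:C)^-1 by rewrite -[RHS]div1r.
  rewrite cmodV cmod_real.
  by rewrite (ger0_norm (ltW b0)) lerDr sqr_ge0.
have normB : `|-1 : R| + `|0 : R| = 1 by rewrite normrN normr1 (@normr0 R R) addr0.
have normA : `|0 : R| + `|1 : R| = 1 by rewrite normr1 (@normr0 R R) add0r.
have b0V : 0 < (b 0%N)^-1 ^+ 2 by rewrite exprn_gt0 // invr_gt0.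
have [regB regD] := lim_regular_growth normB ltr01 first_kind.
have [regA regC] := lim_regular_growth normA b0V second_kind.
case: (nevanlinna_entry i j) => ->.
- rewrite nevanlinnaA_limX; exact: regA.
- rewrite nevanlinnaB_limX; exact: regB.
- rewrite nevanlinnaC_limY; exact: regC.
- rewrite nevanlinnaD_limY; exact: regD.
Qed.

Lemma orthopoly1_l2 z : l2 (fun n => orthopoly1 a b n z).
Proof.
apply/l2P; have := sqr_csol_summable b_gt0 sum_invb weight_le z (-1) 0.
by move=> [M hM]; exists M => n; under eq_bigr do rewrite orthopoly1_csol.
Qed.

End Entries.

(** The regularity conditions enter the proof through this estimate alone. *)
Lemma transfer_weight_le (R : realType) (a b : nat -> R) :
  (forall n, 0 < b n) ->
  bounded_sums (fun n => `|b n / Num.sqrt (b n.-1 * b n.+1) - 1|) ->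
  bounded_sums (fun n => `|jacobi_beta a b n.+1 - jacobi_beta a b n|) ->
  (exists2 l : R, (jacobi_beta a b n @[n --> \oo] --> l) & -1 < l < 1) ->
  exists K, forall n, b n * transfer_weight a b n <= K.
Proof.
move=> b_gt0 reg bv lim.
have [Kp hp] := real_solution_bounded b_gt0 reg bv lim
  (real_sol_rec a b_gt0 1 (- a 0%N / b 0%N)).
have [Kq hq] := real_solution_bounded b_gt0 reg bv lim
  (real_sol_rec a b_gt0 0 (b 0%N)^-1).
exists (2 * (Kp + Kq)) => n.
apply: (@le_trans _ _ (2 * (b n * p0 a b n ^+ 2 + b n * q0 a b n ^+ 2))).
  rewrite -mulrDr [leRHS]mulrCA ler_wpM2l ?(ltW (b_gt0 n)) // /transfer_weight.
  rewrite -(real_normK (num_real (p0 a b n))) -(real_normK (num_real (q0 a b n))).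
  set x := `|p0 a b n|; set y := `|q0 a b n|; rewrite -subr_ge0.
  have -> : 2 * (x ^+ 2 + y ^+ 2) - (x + y) ^+ 2 = (x - y) ^+ 2 by ring.
  exact: sqr_ge0.
by rewrite ler_pM2l // lerD ?hp ?hq.
Qed.

Unset Implicit Arguments.

Theorem theorem4p14 (R : realType) (a b : nat -> R)
  (b_gt0 : forall n, 0 < b n)
  (sum_invb : (\sum_(1 <= n <oo) ((b n)^-1)%:E < +oo)%E)
  (bv_beta : (\sum_(1 <= n <oo)
     `|jacobi_beta a b n.+1 - jacobi_beta a b n|%:E < +oo)%E)
  (lim_beta : exists2 l : R,
     (jacobi_beta a b n @[n --> \oo] --> l) & -1 < l < 1)
  (reg_b : (\sum_(1 <= n <oo)
     `|b n / Num.sqrt (b n.-1 * b n.+1) - 1|%:E < +oo)%E) :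
  [/\ limit_circle a b,
      mx_has_order (nevanlinna a b) (convergence_exponent b) &
      forall rho : R, mx_has_order (nevanlinna a b) rho%:E ->
        (\sum_(0 <= n <oo) (b n `^ (- rho))%:E < +oo)%E ->
        mx_finite_type (nevanlinna a b) rho].
Proof.
have bs_invb : bounded_sums (fun n => (b n)^-1).
  by apply: bounded_sums_of_nneseries sum_invb => n; rewrite invr_ge0 ltW.
have bs_beta := bounded_sums_of_nneseries (fun n => normr_ge0 _) bv_beta.
have bs_reg := bounded_sums_of_nneseries (fun n => normr_ge0 _) reg_b.
have [K weight_le] := transfer_weight_le b_gt0 bs_reg bs_beta lim_beta.
have reg := nevanlinna_regular_growth b_gt0 bs_invb weight_le.
split.
- by apply: limit_circle_of_l2 => //; exact: orthopoly1_l2 weight_le _.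
- by move=> i j; have [] := reg i j.
move=> rho ord sum_rho i j; have [_ fin] := reg i j.
apply: fin; first exact: ord.
by apply: bounded_sums_of_nneseries sum_rho => n; exact: powR_ge0.
Qed.
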